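(* Let $\Pi^{\mathrm{even}}$ be the orthogonal projection of $L^2(S^1)$ onto the closed span of $\{e^{2in\theta}:n\ge0\}$. The algebra of differential operators on $S^1$ which commute with $\Pi^{\mathrm{even}}$ has for its symbol algebra the algebra of even polynomials on the cut space $(T^*S^1)_+=\mathbb C$. That is, with $\sigma:[0,\infty)\times S^1\to\mathbb C$, $\sigma(s,\lambda)=\lambda^{-1}\sqrt s$, the complex linear span of the principal symbols, restricted to $\{s\ge0\}\subset T^*S^1$, of differential operators on $S^1$ commuting with $\Pi^{\mathrm{even}}$ equals $$\{\sigma^*f: f\in\mathbb C[z,\bar z],\ f(-z,-\bar z)=f(z,\bar z)\}.$$
   Context: Differential operators on $S^1$ have smooth complex coefficients. $T^*S^1=\mathbb R\times S^1$ with coordinates $(s,\lambda=e^{i\theta})$; the principal symbol of $\sum_{r=0}^df_r(\theta)\left(\frac1i\frac{d}{d\theta}\right)^r$ with $f_d\not\equiv0$ is $f_d(\theta)s^d$. $(T^*S^1)_+$ is the symplectic cut of $T^*S^1$ with respect to the rotation action with moment map $s$: the quotient of $\{(s,\lambda,z)\in\mathbb R\times S^1\times\mathbb C:s=|z|^2\}$ by $\mu\cdot(s,\lambda,z)=(s,\mu\lambda,\mu z)$, identified with $\mathbb C$ by $(s,\lambda,z)\mapsto\lambda^{-1}z$; the map $\sigma$ is the composition of $(s,\lambda)\mapsto(s,\lambda,\sqrt s)$ with this identification. *)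

(* Defs.v *)
From HB Require Import structures.
From mathcomp Require Import all_boot all_order all_algebra.
From mathcomp Require Import polyXY.
From mathcomp Require Import complex.
From mathcomp Require Import all_classical all_reals all_analysis.

Set Implicit Arguments.
Unset Strict Implicit.
Unset Printing Implicit Defensive.

Import Order.TTheory GRing.Theory Num.Theory.
Import numFieldNormedType.Exports.

Local Open Scope classical_set_scope.
Local Open Scope ring_scope.
Local Open Scope complex_scope.

Definition circle (R : realType) : Type := {z : R[i] | `|z| == 1}.

Lemma expi_subproof (R : realType) (t : R) : `|cos t +i* sin t| == 1 :> R[i].
Proof. by rewrite normc_def /= cos2Dsin2 sqrtr1. Qed.

Definition expi (R : realType) (t : R) : circle R :=
  exist _ (cos t +i* sin t) (expi_subproof t).

Lemma rot_subproof (R : realType) (l m : circle R) : `|val l * val m| == 1.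
Proof. by rewrite normrM (eqP (valP l)) (eqP (valP m)) mulr1. Qed.

Definition rot (R : realType) (l m : circle R) : circle R :=
  exist _ (val l * val m) (rot_subproof l m).

Definition smooth (R : realType) (f : circle R -> R[i]) : Prop :=
  forall (n : nat) (t : R),
    derivable (derive1n n (fun x => complex.Re (f (expi x)))) t 1 /\
    derivable (derive1n n (fun x => complex.Im (f (expi x)))) t 1.

(* d/dtheta, as the derivative of f at l along t |-> l * e^(it). *)
Definition dtheta (R : realType) (f : circle R -> R[i]) : circle R -> R[i] :=
  fun l => derive1 (fun t : R => complex.Re (f (rot l (expi t)))) 0 +i*
           derive1 (fun t : R => complex.Im (f (rot l (expi t)))) 0.

Definition Dtheta (R : realType) (f : circle R -> R[i]) : circle R -> R[i] :=
  fun l => 'i%C^-1 * dtheta f l.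

(* Only the coefficients f 0, ..., f d matter. *)
Definition diffop (R : realType) (d : nat) (f : nat -> circle R -> R[i])
    (u : circle R -> R[i]) : circle R -> R[i] :=
  fun l => \sum_(r < d.+1) f r l * iter r (@Dtheta R) u l.

(* Elements of L^2(S^1) are represented by functions, not by a.e. classes. *)
Definition L2 (R : realType) (f : circle R -> R[i]) : Prop :=
  [/\ measurable_fun `[0, 2 * pi]%classic
        (fun t : R => complex.Re (f (expi t))),
      measurable_fun `[0, 2 * pi]%classic
        (fun t : R => complex.Im (f (expi t))) &
      (@lebesgue_measure R).-integrable `[0, 2 * pi]%classic
        (fun t : R => (complex.Re (f (expi t)) ^+ 2 +
                       complex.Im (f (expi t)) ^+ 2)%:E)].

Definition circle_integral (R : realType) (f : circle R -> R[i]) : R[i] :=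
  (\int[@lebesgue_measure R]_(t in `[0%R, 2 * pi]) complex.Re (f (expi t))) +i*
  (\int[@lebesgue_measure R]_(t in `[0%R, 2 * pi]) complex.Im (f (expi t))).

Definition inner (R : realType) (f g : circle R -> R[i]) : R[i] :=
  circle_integral (fun l => f l * ((g l)^*)%C).

Definition L2norm (R : realType) (f : circle R -> R[i]) : R :=
  Num.sqrt (complex.Re (inner f f)).

Definition cspan (R : realType) (T : Type) (A : set (T -> R[i])) :
    set (T -> R[i]) :=
  [set g | exists (n : nat) (c : 'I_n -> R[i]) (h : 'I_n -> T -> R[i]),
     (forall i, A (h i)) /\ g = fun x => \sum_(i < n) c i * h i x].

Definition closed_span (R : realType) (A : set (circle R -> R[i])) :
    set (circle R -> R[i]) :=
  [set v | L2 v /\ forall eps : R, 0 < eps ->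
     exists2 p, cspan A p & L2norm (fun l => v l - p l) < eps].

(* v represents the orthogonal projection of u onto K; it is determined by u
   up to equality almost everywhere. *)
Definition orth_proj (R : realType) (K : set (circle R -> R[i]))
    (u v : circle R -> R[i]) : Prop :=
  [/\ L2 u, K v & forall w, K w -> inner (fun l => u l - v l) w = 0].

Definition Pi_even (R : realType) : (circle R -> R[i]) ->
    (circle R -> R[i]) -> Prop :=
  orth_proj (closed_span [set fun l : circle R => val l ^+ (2 * n) | n in setT]).

(* Equality Pi D = D Pi of operators on C^oo(S^1), which Pi^even maps to
   itself: v is the smooth representative of Pi^even u. *)
Definition commutes_Pi_even (R : realType)
    (D : (circle R -> R[i]) -> circle R -> R[i]) : Prop :=
  forall u, smooth u ->
    exists2 v, smooth v & Pi_even u v /\ Pi_even (D u) (D v).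

(* Functions on [0, +oo[ * S^1, the part s >= 0 of T^*S^1. *)
Definition half_cotangent (R : realType) : Type := ({nonneg R} * circle R)%type.

Definition principal_symbol (R : realType) (d : nat)
    (f : nat -> circle R -> R[i]) : R * circle R -> R[i] :=
  fun p => f d p.2 * (p.1%:C) ^+ d.

Definition commuting_symbols (R : realType) : set (half_cotangent R -> R[i]) :=
  [set q | exists (d : nat) (f : nat -> circle R -> R[i]),
     [/\ forall r, (r <= d)%N -> smooth (f r),
         exists l, f d l != 0,
         commutes_Pi_even (diffop d f) &
         q = fun p => principal_symbol d f (p.1%:num, p.2)]].

Definition sigma (R : realType) (p : half_cotangent R) : R[i] :=
  (val p.2)^-1 * (Num.sqrt p.1%:num)%:C.

(* f : {poly {poly R[i]}} stands for an element of C[z, zbar], with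
   f.[z, z^*] its value at z. *)
Definition even_pullbacks (R : realType) : set (half_cotangent R -> R[i]) :=
  [set q | exists2 f : {poly {poly R[i]}},
     forall z : R[i], f.[- z, - (z^*)%C] = f.[z, (z^*)%C] &
     q = fun p => f.[sigma p, ((sigma p)^*)%C]].

(* Main.v *)
Require Import Defs.
From mathcomp Require Import all_boot all_order all_algebra.
From mathcomp Require Import polyXY ring lra zify.
From mathcomp Require Import complex.
From mathcomp Require Import all_classical all_reals all_analysis.
From mathcomp Require Import measurable_realfun.

(** The Fourier modes e_k(lambda) = lambda^k diagonalize both operators at hand:
    D = (1/i) d/dtheta multiplies e_k by k, and on smooth functions the even
    projection is the Fourier multiplier by the indicator function of the set E of
    even nonnegative integers (Pi_evenP). If a differential operator
    A = sum_(r <= d) a_r D^r commutes with the projection, its matrix entries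
    between e_n and e_k therefore vanish whenever exactly one of n and k lies in E
    (commutes_coef).

    On a diagonal k - n = j the entry is a polynomial in n of degree at most d,
    whose coefficients are the j-th Fourier coefficients of a_0, ..., a_d
    (fc_diffop_ek). If j is odd, infinitely many n are separated from n + j by E;
    if j = 2m, exactly |m| integers are. As a nonzero polynomial of degree at most d
    has at most d roots, the leading coefficient a_d involves only the modes e_(2m)
    with |m| <= d (symbol_support), and a_d(lambda) s^d is a combination of the
    lambda^(2m) s^d with |m| <= d. Conversely, for |m| <= d there is a monic
    polynomial p of degree d vanishing at the |m| separated integers; then e_(2m) p(D)
    commutes with the projection (commutes_mode) and has symbol lambda^(2m) s^d.
    Finally lambda^(2m) s^d is the pullback by sigma of z^(d-m) zbar^(d+m)
    (sigma_monoE), and these are the monomials of even degree in z and zbar.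

    Two facts of analysis support this. A smooth function with vanishing Fourier
    coefficients is zero (fc_eq0): it is orthogonal to all the trigonometric
    polynomials cos^(2n)((t - t0) / 2), whose mass concentrates at t0
    (kernel_vanish). And a Fourier series with rapidly decreasing coefficients is
    smooth and lies in the closed span of its modes (smooth_fsum,
    fsum_closed_span), so that the projection preserves smooth functions and the
    description of the projection by its Fourier coefficients is an equivalence. *)

Set Implicit Arguments.
Unset Strict Implicit.
Unset Printing Implicit Defensive.

Import Order.TTheory GRing.Theory Num.Theory.
Import numFieldNormedType.Exports Normc.

Local Open Scope classical_set_scope.
Local Open Scope ring_scope.
Local Open Scope complex_scope.

Local Notation Re := complex.Re.
Local Notation Im := complex.Im.

(** * Real and imaginary parts *)

Section ComplexParts.
Variable R : realType.
Implicit Types x y z : R[i].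

Lemma cReM x y : Re (x * y) = Re x * Re y - Im x * Im y.
Proof. by case: x; case: y. Qed.

Lemma cImM x y : Im (x * y) = Re x * Im y + Im x * Re y.
Proof. by case: x; case: y. Qed.

Lemma cReD x y : Re (x + y) = Re x + Re y.
Proof. by case: x; case: y. Qed.

Lemma cImD x y : Im (x + y) = Im x + Im y.
Proof. by case: x; case: y. Qed.

Lemma cReN x : Re (- x) = - Re x.
Proof. by case: x. Qed.

Lemma cImN x : Im (- x) = - Im x.
Proof. by case: x. Qed.

Lemma cReJ x : Re (x^*)%C = Re x.
Proof. by case: x. Qed.

Lemma cImJ x : Im (x^*)%C = - Im x.
Proof. by case: x. Qed.

Definition cpartE := (cReM, cImM, cReD, cImD, cReN, cImN, cReJ, cImJ).

Lemma complex_ext x y : Re x = Re y -> Im x = Im y -> x = y.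
Proof. by case: x y => [a b] [c d] /= -> ->. Qed.

Lemma Re_sum I (r : seq I) (P : pred I) (F : I -> R[i]) :
  Re (\sum_(i <- r | P i) F i) = \sum_(i <- r | P i) Re (F i).
Proof. by elim/big_rec2: _ => // i x y _ <-; rewrite cReD. Qed.

Lemma Im_sum I (r : seq I) (P : pred I) (F : I -> R[i]) :
  Im (\sum_(i <- r | P i) F i) = \sum_(i <- r | P i) Im (F i).
Proof. by elim/big_rec2: _ => // i x y _ <-; rewrite cImD. Qed.

Lemma i_neq0 : 'i%C != 0 :> R[i].
Proof. by rewrite eq_complex /= negb_and oner_eq0 orbT. Qed.

Lemma abs_Re_le x : `|Re x| <= normc x.
Proof.
case: x => a b /=; rewrite -sqrtr_sqr ler_sqrt ?addr_ge0 ?sqr_ge0//.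
by rewrite lerDl sqr_ge0.
Qed.

Lemma abs_Im_le x : `|Im x| <= normc x.
Proof.
case: x => a b /=; rewrite -sqrtr_sqr ler_sqrt ?addr_ge0 ?sqr_ge0//.
by rewrite lerDr sqr_ge0.
Qed.

Lemma normc_le_abs x : normc x <= `|Re x| + `|Im x|.
Proof.
case: x => a b /=.
rewrite -(ger0_norm (addr_ge0 (normr_ge0 a) (normr_ge0 b))) -sqrtr_sqr.
rewrite ler_sqrt ?sqr_ge0// sqrrD !real_normK ?num_real//.
by rewrite -addrAC lerDl mulrn_wge0// mulr_ge0.
Qed.

Lemma normc_nat (n : nat) : normc (n%:R : R[i]) = n%:R.
Proof.
have -> : n%:R = (n%:R : R)%:C by rewrite rmorph_nat.
by rewrite /= expr0n addr0 sqrtr_sqr normr_nat.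
Qed.

End ComplexParts.

(** * Derivatives of complex functions of a real variable *)

Section ComplexDerivative.
Variable R : realType.
Implicit Types F G H K : R -> R[i].

(** The derivative of a complex function of a real variable is taken part by
    part, in the same way as smoothness on the circle is defined. *)
Definition cder F G := forall t : R,
  is_derive t (1 : R) (fun x => Re (F x)) (Re (G t)) /\
  is_derive t (1 : R) (fun x => Im (F x)) (Im (G t)).

Lemma eq_cder F G F' G' : cder F G -> F =1 F' -> G =1 G' -> cder F' G'.
Proof. by move=> FG /funext <- /funext <-. Qed.

Lemma cder_derive1 F G : cder F G ->
  G = fun t => derive1 (fun x => Re (F x)) t +i* derive1 (fun x => Im (F x)) t.
Proof.
move=> FG; apply/funext => t; have [[_ a1] [_ a2]] := FG t.
by apply: complex_ext; rewrite /= derive1E.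
Qed.

Lemma cderD F G F' G' : cder F F' -> cder G G' ->
  cder (fun t => F t + G t) (fun t => F' t + G' t).
Proof.
move=> FF GG t; have [a1 a2] := FF t; have [b1 b2] := GG t; split.
- rewrite (_ : (fun x => _) = (fun x => Re (F x)) + (fun x => Re (G x))).
    by rewrite cReD; exact: is_deriveD.
  by apply/funext => x; rewrite cReD.
- rewrite (_ : (fun x => _) = (fun x => Im (F x)) + (fun x => Im (G x))).
    by rewrite cImD; exact: is_deriveD.
  by apply/funext => x; rewrite cImD.
Qed.

Lemma cderM F G F' G' : cder F F' -> cder G G' ->
  cder (fun t => F t * G t) (fun t => F' t * G t + F t * G' t).
Proof.
move=> FF GG t; have [a1 a2] := FF t; have [b1 b2] := GG t; split.
- rewrite (_ : (fun x => _) = (fun x => Re (F x)) * (fun x => Re (G x))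
     - (fun x => Im (F x)) * (fun x => Im (G x))).
    apply: (is_derive_eq (is_deriveB (is_deriveM a1 b1) (is_deriveM a2 b2))).
    rewrite !cpartE /GRing.scale /=; ring.
  by apply/funext => x; rewrite cReM.
- rewrite (_ : (fun x => _) = (fun x => Re (F x)) * (fun x => Im (G x))
     + (fun x => Im (F x)) * (fun x => Re (G x))).
    apply: (is_derive_eq (is_deriveD (is_deriveM a1 b2) (is_deriveM a2 b1))).
    rewrite !cpartE /GRing.scale /=; ring.
  by apply/funext => x; rewrite cImM.
Qed.

Lemma cder_cst (c : R[i]) : cder (fun=> c) (fun=> 0).
Proof. by move=> t; split; exact: is_derive_cst. Qed.

Lemma cderZ (c : R[i]) F F' : cder F F' ->
  cder (fun t => c * F t) (fun t => c * F' t).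
Proof.
move=> FF; have := cderM (cder_cst c) FF; congr cder.
by apply/funext => t; rewrite mul0r add0r.
Qed.

Lemma cder_sum (I : Type) (r : seq I) (F F' : I -> R -> R[i]) :
  (forall i, cder (F i) (F' i)) ->
  cder (fun t => \sum_(i <- r) F i t) (fun t => \sum_(i <- r) F' i t).
Proof.
move=> FF; elim: r => [|i r IH].
  by have := cder_cst 0; congr cder; apply/funext => t; rewrite big_nil.
by have := cderD (FF i) IH; congr cder; apply/funext => t; rewrite big_cons.
Qed.

(** The recursive form of the class C^n makes stability under products a short
    induction, with no Leibniz formula for iterated derivatives. *)
Fixpoint Ck (n : nat) F : Prop :=
  if n is m.+1 then exists2 G, cder F G & Ck m G else True.

Lemma CkS n F : Ck n.+1 F -> Ck n F.
Proof.
elim: n F => [//|n IH] F [G FG /IH CG].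
by exists G.
Qed.

Lemma CkD n F G : Ck n F -> Ck n G -> Ck n (fun t => F t + G t).
Proof.
elim: n F G => [//|n IH] F G [F' FF CF] [G' GG CG].
by exists (fun t => F' t + G' t); [exact: cderD|exact: IH].
Qed.

Lemma CkM n F G : Ck n F -> Ck n G -> Ck n (fun t => F t * G t).
Proof.
elim: n F G => [//|n IH] F G CF CG.
have CF0 := CkS CF; have CG0 := CkS CG.
case: CF => F' FF CF; case: CG => G' GG CG.
by exists (fun t => F' t * G t + F t * G' t);
  [exact: cderM | apply: CkD; exact: IH].
Qed.

Lemma Ck_cst n (c : R[i]) : Ck n (fun=> c).
Proof.
by elim: n c => [//|n IH] c; exists (fun=> 0); [exact: cder_cst|exact: IH].
Qed.

(** Both sides unfold one derivative at a time: the iterated real derivatives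
    of the parts provide the witnesses of Ck, and such witnesses are unique. *)
Lemma Ck_smooth (f : circle R -> R[i]) :
  smooth f <-> forall n, Ck n (fun t => f (expi t)).
Proof.
split.
- move=> sf.
  suff H n m : Ck n (fun t => derive1n m (fun x => Re (f (expi x))) t +i*
                     derive1n m (fun x => Im (f (expi x))) t).
    move=> n; have := H n 0%N; congr Ck; apply/funext => t.
    by apply: complex_ext.
  elim: n m => [//|n IH] m /=.
  exists (fun t => derive1n m.+1 (fun x => Re (f (expi x))) t +i*
                   derive1n m.+1 (fun x => Im (f (expi x))) t).
    move=> t; have [/derivableP d1 /derivableP d2] := sf m t.
    by split; rewrite derive1nS [X in is_derive _ _ _ X]derive1E.
  exact: IH.
- move=> Cf n.
  suff H F : Ck n.+1 F -> forall t : R,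
    derivable (derive1n n (fun x => Re (F x))) t 1 /\
    derivable (derive1n n (fun x => Im (F x))) t 1 by exact: H.
  elim: n F => [|n IH] F [G FG CG] t.
    by have [a b] := FG t; split; [exact: a.(ex_derive)|exact: b.(ex_derive)].
  have := IH _ CG t; by rewrite (cder_derive1 FG) !derive1Sn.
Qed.

End ComplexDerivative.

(** * Smooth functions on the circle and their Fourier modes *)

Section Circle.
Variable R : realType.
Implicit Types (f g : circle R -> R[i]) (l : circle R) (k : int).

Lemma circle_inj (l m : circle R) : val l = val m -> l = m.
Proof. exact: val_inj. Qed.

Lemma circle_sqr l : Re (val l) ^+ 2 + Im (val l) ^+ 2 = 1.
Proof.
case: l => -[a b] /=; rewrite normc_def => /eqP[] /= h.
by rewrite -[LHS]sqr_sqrtr ?addr_ge0 ?sqr_ge0// h expr1n.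
Qed.

Lemma circle_conj l : val l * (val l)^*%C = 1.
Proof. by rewrite -sqr_normc (eqP (valP l)) expr1n. Qed.

Lemma circle_neq0 l : val l != 0.
Proof. by rewrite -normr_eq0 (eqP (valP l)) oner_eq0. Qed.

Lemma circle_conjV l : (val l)^*%C = (val l)^-1.
Proof.
by apply: (mulfI (circle_neq0 l)); rewrite circle_conj divff ?circle_neq0.
Qed.

Lemma expi_surj l : exists2 t : R, 0 <= t <= 2 * pi & l = expi t.
Proof.
have := circle_sqr l; set x := Re _; set y := Im _ => xy.
have x1 : -1 <= x <= 1.
  have y2 : 0 <= y ^+ 2 by exact: sqr_ge0.
  by apply/andP; split; nra.
have p0 := acos_ge0 x1; have p1 := acos_lepi x1.
have sy : sin (acos x) = `|y|.
  by rewrite sin_acos// -xy addrAC subrr add0r sqrtr_sqr.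
have cx : cos (acos x) = x by rewrite acosK// in_itv.
have pi0 := pi_gt0 R.
have [y0|y0] := leP 0 y.
  exists (acos x); first by rewrite p0 /=; lra.
  apply: circle_inj; apply: complex_ext => /=; first by rewrite cx.
  by rewrite sy ger0_norm.
have e : 2 * pi - acos x = - acos x + pi *+ 2 by rewrite mulr_natl addrC.
exists (2 * pi - acos x); first by apply/andP; split; lra.
apply: circle_inj; apply: complex_ext; rewrite /= e.
  by rewrite cosD2pi cosN cx.
by rewrite sinD2pi sinN sy ltr0_norm// opprK.
Qed.

Lemma expiD (s t : R) : Defs.rot (expi s) (expi t) = expi (s + t).
Proof.
apply: circle_inj; apply: complex_ext; rewrite /= ?cosD ?sinD//.
by rewrite addrC [cos s * _]mulrC.
Qed.

Lemma expi_2pi (t : R) : expi (t + 2 * pi) = expi t.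
Proof.
by apply: circle_inj; rewrite /= mulr_natl cosD2pi sinD2pi.
Qed.

Lemma expi_ext (A : Type) (f g : circle R -> A) :
  (forall t : R, f (expi t) = g (expi t)) -> f = g.
Proof. by move=> fg; apply/funext => l; have [t _ ->] := expi_surj l. Qed.

Lemma cder_shift (F G : R -> R[i]) (s : R) : cder F G ->
  cder (fun t => F (s + t)) (fun t => G (s + t)).
Proof.
move=> FG t; have [a b] := FG (s + t).
have h : is_derive t (1 : R) (fun x : R => s + x) 1.
  rewrite (_ : (fun x => _) = cst s + id)//.
  by apply: is_derive_eq; rewrite add0r.
split.
- have := @is_derive1_comp _ (fun x => Re (F x)) (fun x => s + x) t _ _ a h.
  by rewrite mulr1.
- have := @is_derive1_comp _ (fun x => Im (F x)) (fun x => s + x) t _ _ b h.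
  by rewrite mulr1.
Qed.

(** Rotating by e^(it) adds t to the angle, so the derivative along rotations
    is the ordinary derivative in the angle. *)
Lemma cder_dtheta f (G : R -> R[i]) : cder (fun t => f (expi t)) G ->
  forall t, dtheta f (expi t) = G t.
Proof.
move=> fG t; have := cder_derive1 (cder_shift t fG).
move=> /(congr1 (fun H => H 0)) /=; rewrite addr0 => ->.
rewrite /dtheta; congr (_ +i* _).
- by congr (derive1 _ 0); apply/funext => x; rewrite expiD.
- by congr (derive1 _ 0); apply/funext => x; rewrite expiD.
Qed.

Lemma smooth_cder f : smooth f ->
  cder (fun t => f (expi t)) (fun t => dtheta f (expi t)).
Proof.
move=> /Ck_smooth /(_ 1%N)[G fG _].
by rewrite [X in cder _ X](_ : _ = G)//; apply/funext; exact: cder_dtheta.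
Qed.

Lemma smooth_dtheta f : smooth f -> smooth (dtheta f).
Proof.
move=> /Ck_smooth sf; apply/Ck_smooth => n; have [G fG] := sf n.+1.
by congr Ck; apply/funext => t; rewrite (cder_dtheta fG).
Qed.

Lemma smoothD f g : smooth f -> smooth g -> smooth (fun l => f l + g l).
Proof.
by move=> /Ck_smooth sf /Ck_smooth sg; apply/Ck_smooth => n; exact: CkD.
Qed.

Lemma smoothM f g : smooth f -> smooth g -> smooth (fun l => f l * g l).
Proof.
by move=> /Ck_smooth sf /Ck_smooth sg; apply/Ck_smooth => n; exact: CkM.
Qed.

Lemma smooth_cst (c : R[i]) : smooth (fun _ : circle R => c).
Proof. by apply/Ck_smooth => n; exact: Ck_cst. Qed.

Lemma smoothZ (c : R[i]) f : smooth f -> smooth (fun l => c * f l).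
Proof. by apply: smoothM; exact: smooth_cst. Qed.

Lemma smooth_sum (I : Type) (r : seq I) (F : I -> circle R -> R[i]) :
  (forall i, smooth (F i)) -> smooth (fun l => \sum_(i <- r) F i l).
Proof.
move=> sF; elim: r => [|i r IH].
  have := smooth_cst 0; congr smooth; apply/funext => l.
  by rewrite big_nil.
have := smoothD (sF i) IH; congr smooth; apply/funext => l.
by rewrite big_cons.
Qed.

Lemma smooth_Dtheta f : smooth f -> smooth (Dtheta f).
Proof. by move=> sf; exact/smoothZ/smooth_dtheta. Qed.

Lemma smooth_iter_Dtheta f r : smooth f -> smooth (iter r (@Dtheta R) f).
Proof.
by move=> sf; elim: r => [//|r IH]; rewrite iterS; exact: smooth_Dtheta.
Qed.

Lemma smooth_diffop d (a : nat -> circle R -> R[i]) f :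
  (forall r, (r <= d)%N -> smooth (a r)) -> smooth f -> smooth (diffop d a f).
Proof.
move=> sa sf; apply: smooth_sum => r.
by apply: smoothM; [apply: sa; rewrite -ltnS|exact: smooth_iter_Dtheta].
Qed.

Lemma smooth_cderD f : smooth f ->
  cder (fun t => f (expi t)) (fun t => 'i%C * Dtheta f (expi t)).
Proof.
move=> /smooth_cder; congr cder; apply/funext => t.
by rewrite /Dtheta mulrA divff ?mul1r ?i_neq0.
Qed.

Definition ek k l : R[i] := val l ^ k.

Lemma ekD k j l : ek (k + j) l = ek k l * ek j l.
Proof. by rewrite /ek expfzDr// circle_neq0. Qed.

Lemma ek0 l : ek 0 l = 1.
Proof. exact: expr0z. Qed.

(** On the unit circle conjugation is inversion. *)
Lemma ekJ k l : (ek k l)^*%C = ek (- k) l.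
Proof.
rewrite /ek -exprz_inv -circle_conjV.
case: k => n /=; first by rewrite -!exprnP rmorphXn.
by rewrite !NegzE -!exprnN conjc_inv rmorphXn.
Qed.

Lemma normc_ek k l : normc (ek k l) = 1.
Proof.
have h : normc (ek k l) ^+ 2 = 1.
  have := ekD k (- k) l; rewrite subrr ek0 -ekJ.
  case: (ek k l) => a b /= [h _].
  by rewrite sqr_sqrtr ?addr_ge0 ?sqr_ge0// h mulrN opprK -!expr2.
apply/eqP; rewrite -(@eqrXn2 _ 2) ?expr1n ?h//.
by case: (ek k l) => a b; exact: sqrtr_ge0.
Qed.

Lemma cder_expi : cder (fun t => val (expi t : circle R))
  (fun t => 'i%C * val (expi t)).
Proof.
move=> t; split => /=.
  by rewrite mul0r mul1r sub0r; exact: is_derive_cos.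
by rewrite mul0r mul1r add0r; exact: is_derive_sin.
Qed.

Lemma cder_expiV : cder (fun t => (val (expi t : circle R))^-1)
  (fun t => - 'i%C * (val (expi t))^-1).
Proof.
rewrite (_ : (fun _ => _) = fun t : R => (val (expi t))^*%C); last first.
  by apply/funext => t; rewrite circle_conjV.
move=> t; rewrite -circle_conjV; split => /=.
  by rewrite !oppr0 mul0r sub0r mulN1r opprK; exact: is_derive_cos.
rewrite oppr0 mul0r add0r mulN1r.
exact: (is_deriveN (is_derive_sin t)).
Qed.

Lemma cder_exprn (F : R -> R[i]) (c : R[i]) n :
  cder F (fun t => c * F t) ->
  cder (fun t => F t ^+ n) (fun t => (c *+ n) * F t ^+ n).
Proof.
move=> FF; elim: n => [|n IH].
  by apply: eq_cder (cder_cst 1) _ _ => t; rewrite ?expr0 ?mulr0n ?mul0r.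
apply: eq_cder (cderM FF IH) _ _ => t; first by rewrite exprS.
by rewrite mulrSr exprS; ring.
Qed.

(** Differentiating lambda and its inverse and then taking powers gives all
    the modes, without expanding cos (k t) and sin (k t). *)
Lemma cder_ek k :
  cder (fun t => ek k (expi t)) (fun t => 'i%C * (k%:~R * ek k (expi t))).
Proof.
case: k => n.
  apply: eq_cder (cder_exprn n cder_expi) _ _ => t //.
  by rewrite /ek -exprnP -mulr_natr -pmulrn mulrA.
apply: eq_cder (cder_exprn n.+1 cder_expiV) _ _ => t.
  by rewrite /ek NegzE -exprnN exprVn.
rewrite /ek NegzE -exprnN exprVn mulrNz -pmulrn -mulr_natr.
by rewrite !mulNr mulrN mulrA.
Qed.

Lemma Dtheta_ek k : Dtheta (ek k) = fun l => k%:~R * ek k l.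
Proof.
apply: expi_ext => t; rewrite /Dtheta (cder_dtheta (cder_ek k)) mulrA.
by rewrite mulVf ?mul1r ?i_neq0.
Qed.

Lemma DthetaZ (c : R[i]) f : smooth f ->
  Dtheta (fun l => c * f l) = fun l => c * Dtheta f l.
Proof.
move=> sf; apply: expi_ext => t; rewrite /Dtheta.
by rewrite (cder_dtheta (cderZ c (smooth_cder sf))) mulrCA.
Qed.

Lemma smooth_ek k : smooth (ek k).
Proof.
apply/Ck_smooth => n.
suff H (c : R[i]) : Ck n (fun t => c * ek k (expi t)).
  by have := H 1; congr Ck; apply/funext => t; rewrite mul1r.
elim: n c => [//|n IH] c.
exists (fun t => (c * 'i%C * k%:~R) * ek k (expi t)); last exact: IH.
by have := cderZ c (cder_ek k); congr cder; apply/funext => t; rewrite !mulrA.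
Qed.

Lemma iter_Dtheta_ek k r :
  iter r (@Dtheta R) (ek k) = fun l => k%:~R ^+ r * ek k l.
Proof.
elim: r => [|r IH] /=; first by apply/funext => l; rewrite mul1r.
rewrite IH DthetaZ; last exact: smooth_ek.
by rewrite Dtheta_ek; apply/funext => l; rewrite exprSr mulrA.
Qed.

End Circle.

(** * Integrals over one period *)

Section RealIntegrals.
Variable R : realType.
Implicit Types (f g : R -> R).

Local Notation mu := (@lebesgue_measure R).
Local Notation D := (`[0%R, 2 * pi]%classic : set R).

Lemma mu_period : mu D = (2 * pi)%:E.
Proof.
rewrite lebesgue_measure_itv /= lte_fin mulr_gt0 ?pi_gt0//.
by rewrite -EFinB subr0.
Qed.

Definition rint f := mu.-integrable D (EFin \o f).
Definition rI f : R := \int[mu]_(t in D) f t.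

Lemma rint_cont f : continuous f -> rint f.
Proof.
move=> cf; apply: continuous_compact_integrable; first exact: segment_compact.
exact: continuous_subspaceT.
Qed.

Lemma rintD f g : rint f -> rint g -> rint (fun t => f t + g t).
Proof. by move=> rf rg; exact: (integrableD _ rf rg). Qed.

Lemma rintZ (c : R) f : rint f -> rint (fun t => c * f t).
Proof. by move=> rf; exact: (integrableZl _ c rf). Qed.

Lemma rI_D f g : rint f -> rint g -> rI (fun t => f t + g t) = rI f + rI g.
Proof. by move=> rf rg; exact: RintegralD. Qed.

Lemma rI_Z (c : R) f : rint f -> rI (fun t => c * f t) = c * rI f.
Proof. by move=> rf; exact: RintegralZl. Qed.

Lemma rI_cst (c : R) : rI (fun=> c) = 2 * pi * c.
Proof.
rewrite /rI Rintegral_cst// mulrC; congr (_ * _).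
exact: (congr1 fine mu_period).
Qed.

Lemma rint_cst (c : R) : rint (fun=> c).
Proof. by apply: rint_cont => t; exact: cst_continuous. Qed.

Lemma rI_le f g : rint f -> rint g ->
  (forall t, 0 <= t <= 2 * pi -> f t <= g t) -> rI f <= rI g.
Proof.
by move=> rf rg fg; apply: le_Rintegral.
Qed.

Lemma rI_ge0 f : (forall t, 0 <= f t) -> 0 <= rI f.
Proof. by move=> f0; apply: Rintegral_ge0. Qed.

Lemma rI_norm f : rint f -> `|rI f| <= rI (fun t => `|f t|).
Proof. by move=> rf; exact: le_normr_Rintegral. Qed.

Lemma rint_norm f : rint f -> rint (fun t => `|f t|).
Proof. exact: integrable_norm. Qed.

Lemma rint_le f g : measurable_fun D f -> rint g ->
  (forall t, 0 <= t <= 2 * pi -> `|f t| <= g t) -> rint f.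
Proof.
move=> mf rg fg; apply: le_integrable rg => //.
  exact/measurable_realfun.measurable_EFinP.
move=> t /= Dt; by rewrite lee_fin (le_trans (fg t _)) ?ler_norm.
Qed.

Lemma rI_FTC f g : (forall t, is_derive t (1 : R) f (g t)) -> continuous g ->
  rI g = f (2 * pi) - f 0.
Proof.
move=> fg cg.
have cf : continuous f.
  move=> t; apply/differentiable_continuous/derivable1_diffP.
  by have [] := fg t.
have p0 : 0 < 2 * pi :> R by rewrite mulr_gt0 ?pi_gt0.
rewrite /rI /Rintegral (continuous_FTC2 p0 (F := f)) //.
- exact: continuous_subspaceT.
- split; last 2 first.
  + exact/cvg_at_right_filter/cf.
  + exact/cvg_at_left_filter/cf.
  by move=> t _; have [] := fg t.
- by move=> t _; rewrite derive1E; have [_ ->] := fg t.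
Qed.

Lemma continuous_add f g : continuous f -> continuous g ->
  continuous (fun t => f t + g t).
Proof. by move=> cf cg t; exact: (continuousD (cf t) (cg t)). Qed.

Lemma continuous_mul f g : continuous f -> continuous g ->
  continuous (fun t => f t * g t).
Proof. by move=> cf cg t; exact: (continuousM (cf t) (cg t)). Qed.

Lemma continuous_scale (c : R) f : continuous f ->
  continuous (fun t => c * f t).
Proof.
by move=> cf; apply: continuous_mul => // t; exact: cst_continuous.
Qed.

Lemma measurable_cont f : continuous f -> measurable_fun D f.
Proof. 
move=> cf; apply: (@measurable_funTS _ _ _ _ D f).
exact: continuous_measurable_fun.
 Qed.

Lemma cont_bounded f : continuous f ->
  exists2 M : R, 0 <= M & forall t, 0 <= t <= 2 * pi -> `|f t| <= M.
Proof.
move=> cf; have p0 : 0 <= 2 * pi :> R by rewrite mulr_ge0 ?pi_ge0.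
have [|c _ fc] := @EVT_max R (fun t => `|f t|) 0 (2 * pi) p0.
  apply: continuous_subspaceT => t.
  exact: (continuous_comp (@cf t) (@norm_continuous _ _ _)).
by exists `|f c| => // t t01; apply: fc; rewrite in_itv.
Qed.

End RealIntegrals.

(** * Complex integrals over one period *)

Section ComplexIntegrals.
Variable R : realType.
Implicit Types (F G : R -> R[i]).

Definition ccont F := continuous (fun t => Re (F t)) /\
  continuous (fun t => Im (F t)).

Definition cint F := rint (fun t => Re (F t)) /\ rint (fun t => Im (F t)).

Definition cI F : R[i] := rI (fun t => Re (F t)) +i* rI (fun t => Im (F t)).

Lemma circle_integralE (f : circle R -> R[i]) :
  circle_integral f = cI (fun t => f (expi t)).
Proof. by []. Qed.

Lemma cder_ccont F G : cder F G -> ccont F.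
Proof.
move=> FG; split=> t; apply/differentiable_continuous/derivable1_diffP;
  by have [[? _] [? _]] := FG t.
Qed.

Lemma ccontD F G : ccont F -> ccont G -> ccont (fun t => F t + G t).
Proof.
move=> [a b] [c d]; split=> t.
- rewrite (_ : (fun x => _) = (fun x => Re (F x)) + (fun x => Re (G x))).
    by apply: continuousD; [exact: a|exact: c].
  by apply/funext => x; rewrite cReD.
- rewrite (_ : (fun x => _) = (fun x => Im (F x)) + (fun x => Im (G x))).
    by apply: continuousD; [exact: b|exact: d].
  by apply/funext => x; rewrite cImD.
Qed.

Lemma ccontM F G : ccont F -> ccont G -> ccont (fun t => F t * G t).
Proof.
move=> [a b] [c d]; split=> t.
- rewrite (_ : (fun x => _) = (fun x => Re (F x)) * (fun x => Re (G x))
     - (fun x => Im (F x)) * (fun x => Im (G x))).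
    by apply: continuousB; apply: continuousM;
      [exact: a|exact: c|exact: b|exact: d].
  by apply/funext => x; rewrite cReM.
- rewrite (_ : (fun x => _) = (fun x => Re (F x)) * (fun x => Im (G x))
     + (fun x => Im (F x)) * (fun x => Re (G x))).
    by apply: continuousD; apply: continuousM;
      [exact: a|exact: d|exact: b|exact: c].
  by apply/funext => x; rewrite cImM.
Qed.

Lemma ccontJ F : ccont F -> ccont (fun t => (F t)^*%C).
Proof.
move=> [a b]; split=> t.
  by under eq_fun do rewrite cReJ; exact: a.
rewrite (_ : (fun x => _) = - (fun x => Im (F x))).
  by apply: continuousN; exact: b.
by apply/funext => x; rewrite cImJ.
Qed.

Lemma ccont_cst (c : R[i]) : ccont (fun=> c).
Proof. by split=> t; exact: cst_continuous. Qed.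

Lemma ccont_cint F : ccont F -> cint F.
Proof. by move=> [a b]; split; exact: rint_cont. Qed.

Lemma cintD F G : cint F -> cint G -> cint (fun t => F t + G t).
Proof.
move=> [a b] [c d]; split.
  by under eq_fun do rewrite cReD; exact: rintD.
by under eq_fun do rewrite cImD; exact: rintD.
Qed.

Lemma cI_D F G : cint F -> cint G ->
  cI (fun t => F t + G t) = cI F + cI G.
Proof.
move=> [a b] [c d]; apply: complex_ext; rewrite /cI ?cReD ?cImD /=.
  by under eq_fun do rewrite cReD; exact: rI_D.
by under eq_fun do rewrite cImD; exact: rI_D.
Qed.

Lemma cintZ (c : R[i]) F : cint F -> cint (fun t => c * F t).
Proof.
move=> [a b]; split.
  under eq_fun do rewrite cReM -mulNr.
  by apply: rintD; exact: rintZ.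
under eq_fun do rewrite cImM.
by apply: rintD; exact: rintZ.
Qed.

Lemma cI_Z (c : R[i]) F : cint F -> cI (fun t => c * F t) = c * cI F.
Proof.
move=> [a b]; apply: complex_ext; rewrite /cI ?cReM ?cImM /=.
  under eq_fun do rewrite cReM -mulNr.
  by rewrite rI_D ?rI_Z ?mulNr//; exact: rintZ.
under eq_fun do rewrite cImM.
by rewrite rI_D ?rI_Z//; exact: rintZ.
Qed.

Lemma cI_sum (I : Type) (r : seq I) (F : I -> R -> R[i]) :
  (forall i, cint (F i)) ->
  cint (fun t => \sum_(i <- r) F i t) /\
  cI (fun t => \sum_(i <- r) F i t) = \sum_(i <- r) cI (F i).
Proof.
move=> cF; elim: r => [|i r [IH1 IH2]].
  under eq_fun do rewrite big_nil.
  split; first exact/ccont_cint/ccont_cst.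
  rewrite big_nil; apply: complex_ext => /=; exact: (etrans (rI_cst 0) (mulr0 _)).
under eq_fun do rewrite big_cons.
by split; [exact: cintD|rewrite cI_D// IH2 big_cons].
Qed.

Lemma cI_FTC F G : cder F G -> ccont G -> cI G = F (2 * pi) - F 0.
Proof.
move=> FG [a b]; apply: complex_ext; rewrite !cpartE /=.
  by apply: (rI_FTC (f := fun t => Re (F t))) => // t; have [] := FG t.
by apply: (rI_FTC (f := fun t => Im (F t))) => // t; have [] := FG t.
Qed.

End ComplexIntegrals.

(** * Fourier coefficients *)

Section FourierCoefficients.
Variable R : realType.
Implicit Types (f g : circle R -> R[i]) (k : int).

(** Not normalized: the coefficient of e_k in the Fourier series of f is
    fc f k divided by 2 pi. *)
Definition fc f k : R[i] := inner f (ek k).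

Lemma smooth_ccont f : smooth f -> ccont (fun t => f (expi t)).
Proof. by move=> /smooth_cder /cder_ccont. Qed.

Lemma fcE f k : fc f k = cI (fun t => f (expi t) * ek (- k) (expi t)).
Proof.
rewrite /fc /inner circle_integralE; congr cI.
by apply/funext => t; rewrite ekJ.
Qed.

Lemma ccont_ek k : ccont (fun t : R => ek k (expi t)).
Proof. exact/smooth_ccont/smooth_ek. Qed.

Lemma fc_cint f k : smooth f -> cint (fun t => f (expi t) * ek (- k) (expi t)).
Proof.
by move=> sf; apply/ccont_cint/ccontM; [exact: smooth_ccont|exact: ccont_ek].
Qed.

Lemma fcD f g k : smooth f -> smooth g ->
  fc (fun l => f l + g l) k = fc f k + fc g k.
Proof.
move=> sf sg; rewrite !fcE -cI_D; try exact: fc_cint.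
by congr cI; apply/funext => t; rewrite mulrDl.
Qed.

Lemma fcZ (c : R[i]) f k : smooth f -> fc (fun l => c * f l) k = c * fc f k.
Proof.
move=> sf; rewrite !fcE -cI_Z; last exact: fc_cint.
by congr cI; apply/funext => t; rewrite mulrA.
Qed.

Lemma fc_sum (I : Type) (r : seq I) (F : I -> circle R -> R[i]) k :
  (forall i, smooth (F i)) ->
  fc (fun l => \sum_(i <- r) F i l) k = \sum_(i <- r) fc (F i) k.
Proof.
move=> sF; rewrite fcE.
under eq_fun do rewrite mulr_suml.
rewrite (cI_sum r (fun i => fc_cint k (sF i))).2.
by apply: eq_bigr => i _; rewrite fcE.
Qed.

Lemma fcM_ek f j k : fc (fun l => f l * ek j l) k = fc f (k - j).
Proof.
rewrite !fcE; congr cI; apply/funext => t.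
by rewrite -mulrA -ekD opprB addrC.
Qed.

(** Integration by parts: the derivative of f e_(-k) has integral 0 over a
    period, by the fundamental theorem of calculus. *)
Lemma fc_Dtheta f k : smooth f -> fc (Dtheta f) k = k%:~R * fc f k.
Proof.
move=> sf; have sD := smooth_Dtheta sf.
(* Both terms of the product rule are brought to the form c * (g e_(-k)). *)
have := cI_FTC (cderM (smooth_cderD sf) (cder_ek (- k))).
have -> : (fun t : R => 'i%C * Dtheta f (expi t) * ek (- k) (expi t) +
    f (expi t) * ('i%C * ((- k)%:~R * ek (- k) (expi t)))) =
  fun t => 'i%C * (Dtheta f (expi t) * ek (- k) (expi t)) +
    - ('i%C * k%:~R) * (f (expi t) * ek (- k) (expi t)).
  by apply/funext => t; rewrite mulrNz; ring.
move=> /(_ _)/wrap[].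
  by apply: ccontD; (apply: ccontM; first exact: ccont_cst);
    (apply: ccontM; last exact: ccont_ek); exact: smooth_ccont.
rewrite cI_D ?cI_Z -?fcE; do ?[apply: cintZ]; try exact: fc_cint.
rewrite -[2 * pi]add0r expi_2pi subrr => h.
apply: (mulfI (i_neq0 R)); apply/eqP; rewrite -subr_eq0 -[X in _ == X]h.
by rewrite mulNr mulrA.
Qed.

Lemma fc_iter_Dtheta f r k : smooth f ->
  fc (iter r (@Dtheta R) f) k = k%:~R ^+ r * fc f k.
Proof.
move=> sf; elim: r => [|r IH]; first by rewrite mul1r.
by rewrite iterS fc_Dtheta ?IH ?exprS ?mulrA//; exact: smooth_iter_Dtheta.
Qed.

(** Orthogonality follows from the symmetry of D: both j and k multiply the
    pairing of e_j with e_k in the same way. *)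
Lemma fc_ek j k : fc (ek j) k = (2 * pi)%:C *+ (j == k).
Proof.
have [<-|jk] := eqVneq j k.
  rewrite fcE; under eq_fun do rewrite -ekD subrr ek0.
  by apply: complex_ext; rewrite /cI /= rI_cst ?mulr1 ?mulr0.
have : (j - k)%:~R * fc (ek j) k = 0.
  rewrite rmorphB mulrBl -fc_Dtheta ?Dtheta_ek; last exact: smooth_ek.
  by rewrite fcZ ?subrr//; exact: smooth_ek.
by move=> /eqP; rewrite mulf_eq0 intr_eq0 subr_eq0 (negPf jk) => /eqP.
Qed.

Lemma smooth_bounded f : smooth f ->
  exists2 M : R, 0 <= M & forall l, `|Re (f l)| <= M /\ `|Im (f l)| <= M.
Proof.
move=> /smooth_ccont[a b].
have [M1 M10 h1] := cont_bounded a; have [M2 M20 h2] := cont_bounded b.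
exists (M1 + M2); first exact: addr_ge0.
move=> l; have [t t01 ->] := expi_surj l.
by split; [rewrite (le_trans (h1 _ t01)) ?lerDl|
           rewrite (le_trans (h2 _ t01)) ?lerDr].
Qed.

End FourierCoefficients.

(** * Concentration of powers of cos^2 *)

Section SinBound.
Variable R : realType.

Lemma is_derive_lipschitz (f f' : R -> R) (L : R) :
  (forall t, is_derive t (1 : R) f (f' t)) -> (forall t, `|f' t| <= L) ->
  forall x y, `|f x - f y| <= L * `|x - y|.
Proof.
move=> df L1 x y; wlog xy : x y / y <= x => [H|].
  have [yx|/ltW xy] := leP y x; first exact: H.
  by rewrite distrC [`|x - y|]distrC; exact: H.
have cf : {within `[y, x], continuous f}.
  apply: continuous_subspaceT => z.
  by apply/differentiable_continuous/derivable1_diffP; have [] := df z.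
have [c _ ->] := MVT_segment xy (fun z _ => df z) cf.
by rewrite normrM ler_wpM2r.
Qed.

(** With z = y / 2 one has sin y = 2 sin z cos z and sin z >= z cos z, while
    cos^2 z = (1 + cos y) / 2 >= 1 / 2. *)
Lemma sin_ge_half (y : R) : 0 <= y <= pi / 2 -> y <= 2 * sin y.
Proof.
move=> /andP[y0 yp].
have p0 := pi_gt0 R.
have z0 : 0 <= y / 2 by rewrite divr_ge0.
have [c] := MVT_segment z0 (fun z _ => is_derive_sin z)
  (continuous_subspaceT (@continuous_sin R)).
rewrite in_itv /= => /andP[c0 cz]; rewrite sin0 !subr0 => sz.
have cc : cos (y / 2) <= cos c.
  move: cz; rewrite le_eqVlt => /orP[/eqP->//|cz].
  by apply/ltW; rewrite ltr_cos// in_itv /=; apply/andP; split; lra.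
have c2 : 0 <= cos (y / 2).
  by apply: cos_ge0_pihalf; apply/andP; split; lra.
have cy : 0 <= cos y by apply: cos_ge0_pihalf; apply/andP; split; lra.
have ey : y = (y / 2) *+ 2 by rewrite -mulr_natr divfK.
have := cos_mulr2n (y / 2); rewrite -ey => e1.
have := sin_mulr2n (y / 2); rewrite -ey => e2.
rewrite e2 sz mulrnAr -mulrnAl.
move: e1 c2 cc; set a := cos (y / 2); set b := cos c => e1 c2 cc.
have ab : a ^+ 2 <= a * b by rewrite expr2 ler_wpM2l.
have h : 1 <= 2 * a ^+ 2 by lra.
have : y / 2 * 1 <= (y / 2) * (2 * (a * b)) by rewrite ler_wpM2l//; lra.
lra.
Qed.

Lemma abs_le_sin (x : R) : `|x| <= pi -> `|x| <= 4 * `|sin (x / 2)|.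
Proof.
wlog x0 : x / 0 <= x => [H|].
  have [x0|x0] := leP 0 x; first exact: H.
  have := H (- x); rewrite normrN mulNr sinN normrN; apply.
  by rewrite oppr_ge0 ltW.
rewrite ger0_norm// => xp.
have h : x / 2 <= 2 * sin (x / 2).
  by apply: sin_ge_half; apply/andP; split; lra.
rewrite ger0_norm; first by lra.
lra.
Qed.

(** A Lipschitz function of the angle is Lipschitz for the chord distance
    2 |sin ((t - t0) / 2)|, which is what the kernel controls. By periodicity t0
    can be moved by 2 pi, so that t and t0 are at distance at most pi. *)
Lemma periodic_lipschitz (f f' : R -> R) (L : R) (t t0 : R) :
  (forall t, is_derive t (1 : R) f (f' t)) -> (forall t, `|f' t| <= L) ->
  (forall t, f (t + 2 * pi) = f t) ->
  0 <= t <= 2 * pi -> 0 <= t0 <= 2 * pi ->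
  `|f t - f t0| <= 4 * L * `|sin ((t - t0) / 2)|.
Proof.
move=> df L1 pf /andP[ta tb] /andP[ua ub].
have L0 : 0 <= L by apply: le_trans (L1 0).
have lip := is_derive_lipschitz df L1.
have p0 := pi_gt0 R.
have base s : `|t - s| <= pi ->
    `|f t - f s| <= 4 * L * `|sin ((t - s) / 2)|.
  move=> /abs_le_sin h; apply: (le_trans (lip t s)).
  by rewrite -mulrA mulrCA ler_wpM2l.
have [h|h] := leP `|t - t0| pi; first exact: base.
have [u|u] := leP t t0.
  have e : t - (t0 - 2 * pi) = (t - t0) + 2 * pi by ring.
  have := base (t0 - 2 * pi); rewrite -[f (t0 - _)]pf subrK e.
  rewrite [(_ + 2 * pi) / 2]mulrDl [2 * pi]mulrC mulfK// sinDpi normrN; apply.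
  by rewrite ler0_norm in h; [rewrite ger0_norm|]; lra.
have e : t - (t0 + 2 * pi) = (t - t0) - 2 * pi by ring.
have := base (t0 + 2 * pi); rewrite pf e.
rewrite [(_ - 2 * pi) / 2]mulrBl [2 * pi]mulrC mulfK//.
rewrite -[sin (_ - pi)]opprK -sinDpi subrK normrN; apply.
rewrite ger0_norm in h; last by lra.
by rewrite ler0_norm; lra.
Qed.

Lemma is_derive_half (t t0 : R) :
  is_derive t (1 : R) (fun x : R => (x - t0) / 2) (2^-1).
Proof.
rewrite (_ : (fun x => _) = 2^-1 *: (id - cst t0)).
  by apply: is_derive_eq; rewrite subr0 [LHS]mulr1.
by apply/funext => x; rewrite /= mulrC.
Qed.

Definition kernel_mass (t0 : R) n := rI (fun t : R => cos ((t - t0) / 2) ^+ (2 * n)).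

Lemma continuous_kernel (t0 : R) m :
  continuous (fun t : R => cos ((t - t0) / 2) ^+ m).
Proof.
move=> t; apply: (@continuous_comp _ _ _ (fun x : R => cos ((x - t0) / 2))
  (fun y : R => y ^+ m)); last exact: exprn_continuous.
apply/differentiable_continuous/derivable1_diffP.
by have [] := @is_derive1_comp _ cos _ t _ _
  (is_derive_cos _) (is_derive_half t t0).
Qed.

Lemma rint_kernel (t0 : R) m : rint (fun t : R => cos ((t - t0) / 2) ^+ m).
Proof. by apply: rint_cont; exact: continuous_kernel. Qed.

(** The Wallis recursion: the difference of the two sides is the integral of
    the derivative of 2 sin cos^(2n+1) at the angle (t - t0) / 2, a function of
    period 2 pi because the total degree 2n + 2 is even. *)
Lemma kernel_mass_rec (t0 : R) n :
  (2 * n%:R + 2) * kernel_mass t0 n.+1 = (2 * n%:R + 1) * kernel_mass t0 n.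
Proof.
pose f t : R := 2 * (sin ((t - t0) / 2) * cos ((t - t0) / 2) ^+ (2 * n).+1).
have df t : is_derive t (1 : R) f
    ((2 * n%:R + 2) * cos ((t - t0) / 2) ^+ (2 * n.+1) +
     - (2 * n%:R + 1) * cos ((t - t0) / 2) ^+ (2 * n)).
  have dc := @is_derive1_comp _ cos _ t _ _
    (is_derive_cos _) (is_derive_half t t0).
  have ds := @is_derive1_comp _ sin _ t _ _
    (is_derive_sin _) (is_derive_half t t0).
  have := is_deriveZ 2 (is_deriveM ds (is_deriveX (2 * n).+1 dc)).
  rewrite (_ : 2 \*: _ = f); last first.
    by apply/funext => x; rewrite /f exprfctE.
  move=> h; apply: (is_derive_eq h).
  rewrite exprfctE -[_ *: _]/(_ * _) /GRing.scale /= mulnS.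
  set s := sin _; set c := cos _; rewrite !exprS.
  have e : s * s = 1 - c * c by rewrite -!expr2 sin2cos2.
  rewrite -(mulr_natr _ (2 * n).+1) -(natr1 (2 * n)) natrM.
  transitivity (c ^+ (2 * n) * (c * c) - (2 * n%:R + 1) * (c ^+ (2 * n)) * (s * s)).
    by field.
  by rewrite e; ring.
have cg : continuous (fun t => (2 * n%:R + 2) * cos ((t - t0) / 2) ^+ (2 * n.+1) +
     - (2 * n%:R + 1) * cos ((t - t0) / 2) ^+ (2 * n)).
  by apply: continuous_add; apply: continuous_scale; exact: continuous_kernel.
have := rI_FTC df cg.
rewrite rI_D; try by apply: rintZ; exact: rint_kernel.
rewrite !rI_Z; try exact: rint_kernel.
have -> : f (2 * pi) = f 0.
  rewrite /f; have -> : (2 * pi - t0) / 2 = (0 - t0) / 2 + pi by field.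
  rewrite sinDpi cosDpi exprS [X in _ = _ * (_ * X)]exprS.
  by rewrite exprM sqrrN -exprM; ring.
rewrite subrr mulNr => /eqP; rewrite subr_eq0 => /eqP.
by rewrite /kernel_mass.
Qed.

Lemma kernel_mass_gt0 (t0 : R) n : 0 < kernel_mass t0 n.
Proof.
elim: n => [|n IH].
  rewrite /kernel_mass muln0 (_ : (fun _ => _) = fun=> 1).
    by rewrite rI_cst mulr1 mulr_gt0 ?pi_gt0.
  by apply/funext => t; rewrite expr0.
have h : 0 < 2 * n%:R + 2 :> R by rewrite ltr_wpDl// mulr_ge0.
by rewrite -(pmulr_rgt0 _ h) kernel_mass_rec mulr_gt0// ltr_wpDl// mulr_ge0.
Qed.

(** With s = sin ((t - t0) / 2), the Lipschitz bound on |f t - f t0| gives at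
    most e + C s^2 for every e > 0. Integrate against cos^(2n): the integral of
    s^2 cos^(2n) is the difference of two consecutive masses, that is
    1 / (2n + 2) of the mass of cos^(2n), so |f t0| <= e + C / (2n + 2). *)
Lemma kernel_vanish (f f' : R -> R) (L t0 : R) :
  (forall t, is_derive t (1 : R) f (f' t)) -> (forall t, `|f' t| <= L) ->
  (forall t, f (t + 2 * pi) = f t) -> 0 <= t0 <= 2 * pi ->
  (forall n, rI (fun t => f t * cos ((t - t0) / 2) ^+ (2 * n)) = 0) ->
  f t0 = 0.
Proof.
move=> df L1 pf t01 f0.
have L0 : 0 <= L by apply: le_trans (L1 0).
have cf : continuous f.
  move=> t; apply/differentiable_continuous/derivable1_diffP.
  by have [] := df t.
have rf n : rint (fun t => f t * cos ((t - t0) / 2) ^+ (2 * n)).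
  by apply/rint_cont/continuous_mul => //; exact: continuous_kernel.
have key (e : R) n : 0 < e ->
    `|f t0| <= e + 4 * L ^+ 2 / e / (2 * n%:R + 2).
  move=> e0; set C := 4 * L ^+ 2 / e.
  have bnd t : 0 <= t <= 2 * pi ->
      `|f t0 - f t| <= e + C * (1 - cos ((t - t0) / 2) ^+ 2).
    move=> t02; rewrite distrC.
    apply: le_trans (periodic_lipschitz df L1 pf t02 t01) _.
    rewrite -sin2cos2 -[sin _ ^+ 2]real_normK ?num_real//.
    (* 4 L s <= e + 4 L^2 s^2 / e by completing the square. *)
    set s := `|sin _|; rewrite -subr_ge0.
    have -> : e + C * s ^+ 2 - 4 * L * s = (e - 2 * L * s) ^+ 2 / e.
      by rewrite /C; field; lra.
    by rewrite divr_ge0 ?sqr_ge0// ltW.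
  have k0 := kernel_mass_gt0 t0 n.
  rewrite -(ler_pM2r k0) -[kernel_mass t0 n in X in X <= _]gtr0_norm// -normrM.
  have -> : f t0 * kernel_mass t0 n =
      rI (fun t => f t0 * cos ((t - t0) / 2) ^+ (2 * n) +
                   (-1) * (f t * cos ((t - t0) / 2) ^+ (2 * n))).
    rewrite rI_D; last 2 first.
    - by apply: rintZ; exact: rint_kernel.
    - by apply: rintZ; exact: rf.
    by rewrite !rI_Z ?f0 ?mulr0 ?addr0//; exact: rint_kernel.
  have rh : rint (fun t => f t0 * cos ((t - t0) / 2) ^+ (2 * n) +
                   (-1) * (f t * cos ((t - t0) / 2) ^+ (2 * n))).
    apply: rintD; apply: rintZ; [exact: rint_kernel|exact: rf].
  apply: (le_trans (rI_norm rh)).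
  have -> : (e + C / (2 * n%:R + 2)) * kernel_mass t0 n =
      rI (fun t => (e + C) * cos ((t - t0) / 2) ^+ (2 * n) +
                   (- C) * cos ((t - t0) / 2) ^+ (2 * n.+1)).
    rewrite rI_D; try by apply: rintZ; exact: rint_kernel.
    rewrite !rI_Z; try exact: rint_kernel.
    rewrite -/(kernel_mass t0 n) -/(kernel_mass t0 n.+1).
    have h : 0 < 2 * n%:R + 2 :> R by rewrite ltr_wpDl// mulr_ge0.
    have -> : kernel_mass t0 n.+1 = (2 * n%:R + 1) * kernel_mass t0 n / (2 * n%:R + 2).
      by rewrite -kernel_mass_rec mulrAC divff ?mul1r// gt_eqF.
    by field; rewrite gt_eqF.
  apply: rI_le.
  - exact: rint_norm.
  - by apply: rintD; apply: rintZ; exact: rint_kernel.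
  move=> t t02; rewrite mulN1r -mulrBl normrM.
  have c0 : 0 <= cos ((t - t0) / 2) ^+ (2 * n).
    by rewrite exprM exprn_ge0// sqr_ge0.
  rewrite (ger0_norm c0); apply: le_trans (ler_wpM2r c0 (bnd t t02)) _.
  by rewrite mulnS exprD le_eqVlt; apply/orP; left; apply/eqP; ring.
apply/eqP; rewrite -normr_le0; apply/ler_addgt0Pr => e e0; rewrite add0r.
have e2 : 0 < e / 2 by rewrite divr_gt0.
set C := 4 * L ^+ 2 / (e / 2).
have C0 : 0 <= C by rewrite divr_ge0 ?mulr_ge0 ?sqr_ge0// ltW.
pose n := Num.truncn (C / (e / 2)).
have := key (e / 2) n e2; rewrite -/C => h.
have hn : C / (e / 2) < n.+1%:R by exact: Num.Theory.truncnS_gt.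
have n0 : 0 <= n%:R :> R by [].
suff : C / (2 * n%:R + 2) <= e / 2 by lra.
rewrite ler_pdivrMr; last by lra.
rewrite ltr_pdivrMr// mulrC in hn; apply: (le_trans (ltW hn)).
rewrite ler_pM2l//; have -> : n.+1%:R = n%:R + 1 :> R by rewrite -natr1.
lra.
Qed.

End SinBound.

(** * A smooth function is determined by its Fourier coefficients *)

Section Uniqueness.
Variable R : realType.
Implicit Types (f g : circle R -> R[i]).

(** |lambda + m|^2 / 4 expanded as a trigonometric polynomial in lambda; by
    ckernelE it is cos^2 of half the angle between lambda and m. *)
Definition ckernel (m l : circle R) : R[i] :=
  2^-1 + (4^-1 * ek (- 1) m * ek 1 l + 4^-1 * ek 1 m * ek (- 1) l).

Lemma smooth_ckernel m : smooth (ckernel m).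
Proof.
apply: smoothD; first exact: smooth_cst.
by apply: smoothD; apply: smoothZ; exact: smooth_ek.
Qed.

Lemma ckernelE (t0 t : R) :
  ckernel (expi t0) (expi t) = (cos ((t - t0) / 2) ^+ 2)%:C.
Proof.
have e1 (s : R) : ek 1 (expi s) = cos s +i* sin s by [].
have e2 (s : R) : ek (- 1) (expi s) = cos s -i* sin s by rewrite -ekJ e1.
have -> : (cos ((t - t0) / 2) ^+ 2)%:C = ((1 + cos (t - t0)) / 2)%:C.
  congr (_%:C); have := cos_mulr2n ((t - t0) / 2).
  by rewrite -[(_ / 2) *+ 2]mulr_natr divfK// => ->; field.
rewrite cosB /ckernel !e1 !e2.
have -> : 2^-1 = (2^-1 : R)%:C by rewrite fmorphV rmorph_nat.
have -> : 4^-1 = (4^-1 : R)%:C by rewrite fmorphV rmorph_nat.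
by apply: complex_ext; rewrite /=; field.
Qed.

Lemma smooth_kernelX f m n : smooth f ->
  smooth (fun l => f l * ckernel m l ^+ n).
Proof.
move=> sf; elim: n => [|n IH].
  by have := sf; congr smooth; apply/funext => l; rewrite mulr1.
have := smoothM IH (smooth_ckernel m); congr smooth; apply/funext => l.
by rewrite exprSr mulrA.
Qed.

(** Multiplying by a mode shifts the Fourier coefficients, so the functions
    whose coefficients all vanish are stable under multiplication by
    trigonometric polynomials. *)
Lemma fc_kernelX f m n k : smooth f -> (forall k, fc f k = 0) ->
  fc (fun l => f l * ckernel m l ^+ n) k = 0.
Proof.
move=> sf f0; elim: n k => [|n IH] k.
  by rewrite -[RHS](f0 k); congr fc; apply/funext => l; rewrite mulr1.
have sF := smooth_kernelX m n sf.
set F := (fun l => _) in IH sF.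
have -> : (fun l => f l * ckernel m l ^+ n.+1) = fun l =>
    2^-1 * F l + (4^-1 * ek (- 1) m * (F l * ek 1 l) +
    4^-1 * ek 1 m * (F l * ek (- 1) l)).
  by apply/funext => l; rewrite /F exprSr /ckernel; ring.
have s1 j : smooth (fun l => F l * ek j l) by apply: smoothM sF (smooth_ek _).
have z c j : smooth (fun l => c * (F l * ek j l)) by apply: smoothZ (s1 j).
rewrite (fcD _ (smoothZ _ sF) (smoothD (z _ _) (z _ _))) (fcD _ (z _ _) (z _ _)).
rewrite (fcZ _ _ sF) (fcZ _ _ (s1 _)) (fcZ _ _ (s1 _)) !fcM_ek !IH.
by rewrite !mulr0 !addr0.
Qed.

Lemma smooth_parts_derive f : smooth f -> exists2 L : R,
  exists f1' : R -> R, (forall t, is_derive t (1 : R)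
    (fun x => Re (f (expi x))) (f1' t)) /\ (forall t, `|f1' t| <= L) &
  exists f2' : R -> R, (forall t, is_derive t (1 : R)
    (fun x => Im (f (expi x))) (f2' t)) /\ (forall t, `|f2' t| <= L).
Proof.
move=> sf; have [L _ h] := smooth_bounded (smooth_dtheta sf).
exists L.
- exists (fun t => Re (dtheta f (expi t))); split=> t.
    by have [] := smooth_cder sf t.
  by have [] := h (expi t).
- exists (fun t => Im (dtheta f (expi t))); split=> t.
    by have [] := smooth_cder sf t.
  by have [] := h (expi t).
Qed.

Lemma fc_eq0 f : smooth f -> (forall k, fc f k = 0) -> forall l, f l = 0.
Proof.
move=> sf f0 l; have [t0 t01 ->] := expi_surj l.
have int0 n : cI (fun t => f (expi t) * (cos ((t - t0) / 2) ^+ (2 * n))%:C) = 0.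
  rewrite -(fc_kernelX (expi t0) n 0 sf f0) fcE; congr cI; apply/funext => t.
  by rewrite oppr0 ek0 mulr1 ckernelE exprM rmorphXn.
have [L [f1 [d1 b1]] [f2 [d2 b2]]] := smooth_parts_derive sf.
apply: complex_ext.
- apply: (kernel_vanish d1 b1 _ t01) => [t|n]; first by rewrite expi_2pi.
  have /(congr1 (@complex.Re R)) /= := int0 n; rewrite -[RHS]/0 => <-.
  by congr rI; apply/funext => t; rewrite cReM /= mulr0 subr0.
- apply: (kernel_vanish d2 b2 _ t01) => [t|n]; first by rewrite expi_2pi.
  have /(congr1 (@complex.Im R)) /= := int0 n; rewrite -[RHS]/0 => <-.
  by congr rI; apply/funext => t; rewrite cImM /= mulr0 add0r.
Qed.

Lemma fc_inj f g : smooth f -> smooth g -> (forall k, fc f k = fc g k) -> f = g.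
Proof.
move=> sf sg fg; apply/funext => l; apply/eqP; rewrite -subr_eq0 -mulN1r.
have sN := smoothZ (-1) sg.
apply/eqP/(fc_eq0 (smoothD sf sN)) => k.
by rewrite (fcD _ sf sN) (fcZ _ _ sg) fg mulN1r subrr.
Qed.

End Uniqueness.

(** * Square integrable functions and closed spans *)

Section L2.
Variable R : realType.
Implicit Types (f g h : circle R -> R[i]).

Local Notation D := (`[0%R, 2 * pi]%classic : set R).

Definition sqmod f (t : R) : R :=
  Re (f (expi t)) ^+ 2 + Im (f (expi t)) ^+ 2.

Lemma continuous_sqmod f : ccont (fun t => f (expi t)) -> continuous (sqmod f).
Proof.
by move=> [a b]; apply: continuous_add; apply: continuous_mul.
Qed.

Lemma L2_ccont f : ccont (fun t => f (expi t)) -> L2 f.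
Proof.
move=> cf; have [a b] := cf; split.
- exact: measurable_cont.
- exact: measurable_cont.
- exact/rint_cont/continuous_sqmod.
Qed.

Lemma L2_smooth f : smooth f -> L2 f.
Proof. by move=> sf; exact/L2_ccont/smooth_ccont. Qed.

Lemma sqmod_ge0 f t : 0 <= sqmod f t.
Proof. by rewrite addr_ge0 ?sqr_ge0. Qed.

Lemma measurable_sqmod f :
  measurable_fun D (fun t => Re (f (expi t))) ->
  measurable_fun D (fun t => Im (f (expi t))) -> measurable_fun D (sqmod f).
Proof.
by move=> a b; apply: measurable_funD; apply: measurable_funX.
Qed.

Lemma L2B f g : L2 f -> L2 g -> L2 (fun l => f l - g l).
Proof.
move=> [a b rf] [c d rg].
have m1 : measurable_fun D (fun t => Re (f (expi t) - g (expi t))).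
  rewrite (_ : (fun t => _) =
    fun t => Re (f (expi t)) - Re (g (expi t))); first exact: measurable_funB.
  by apply/funext => t; rewrite cReD cReN.
have m2 : measurable_fun D (fun t => Im (f (expi t) - g (expi t))).
  rewrite (_ : (fun t => _) =
    fun t => Im (f (expi t)) - Im (g (expi t))); first exact: measurable_funB.
  by apply/funext => t; rewrite cImD cImN.
split => //.
apply: (@rint_le R _ (fun t => 2 * sqmod f t + 2 * sqmod g t)).
- exact: (@measurable_sqmod (fun l => f l - g l)).
- by apply: rintD; exact: rintZ.
move=> t _; rewrite ger0_norm ?addr_ge0 ?sqr_ge0//.
rewrite !(cReD, cImD, cReN, cImN) /sqmod.
rewrite -subr_ge0; set x := Re _; set y := Re _; set z := Im _; set w := Im _.
have -> : 2 * (x ^+ 2 + z ^+ 2) + 2 * (y ^+ 2 + w ^+ 2) -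
    ((x - y) ^+ 2 + (z - w) ^+ 2) = (x + y) ^+ 2 + (z + w) ^+ 2 by ring.
by rewrite addr_ge0 ?sqr_ge0.
Qed.

Lemma L2normE f : L2norm f = Num.sqrt (rI (sqmod f)).
Proof.
rewrite /L2norm /inner circle_integralE /cI /=.
congr (Num.sqrt _); congr rI; apply/funext => t.
by rewrite cReM cReJ cImJ mulrN opprK -!expr2.
Qed.

(** A substitute for the Cauchy-Schwarz inequality: by
    |x| <= e / 2 + x^2 / (2 e), a square integral at most e^2 makes the pairing
    with a bounded function O(e). *)
Lemma bounded_pairing (a1 a2 h1 h2 : R -> R) (M e : R) :
  measurable_fun D a1 -> measurable_fun D a2 ->
  (forall t, 0 <= t <= 2 * pi -> `|a1 t| <= M /\ `|a2 t| <= M) ->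
  measurable_fun D h1 -> measurable_fun D h2 ->
  rint (fun t => h1 t ^+ 2 + h2 t ^+ 2) -> 0 < e ->
  rI (fun t => h1 t ^+ 2 + h2 t ^+ 2) <= e ^+ 2 ->
  rint (fun t => a1 t * h1 t + a2 t * h2 t) /\
  `|rI (fun t => a1 t * h1 t + a2 t * h2 t)| <= M * (2 * pi + 1) * e.
Proof.
move=> ma1 ma2 aM mh1 mh2 rh e0 he.
have M0 : 0 <= M.
  have [|h _] := aM 0; first by rewrite lexx mulr_ge0 ?pi_ge0.
  exact: le_trans h.
pose G t := M * e + M / (2 * e) * (h1 t ^+ 2 + h2 t ^+ 2).
have rG : rint G by apply: rintD; [exact: rint_cst|exact: rintZ].
have half (x : R) : `|x| <= e / 2 + x ^+ 2 / (2 * e).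
  rewrite -subr_ge0 -[x ^+ 2]real_normK ?num_real//.
  have -> : e / 2 + `|x| ^+ 2 / (2 * e) - `|x| = (`|x| - e) ^+ 2 / (2 * e).
    by field; lra.
  by rewrite divr_ge0 ?sqr_ge0// mulr_ge0// ltW.
have bnd t : 0 <= t <= 2 * pi -> `|a1 t * h1 t + a2 t * h2 t| <= G t.
  move=> /aM[b1 b2]; apply: (le_trans (ler_normD _ _)); rewrite !normrM.
  apply: (@le_trans _ _ (M * (`|h1 t| + `|h2 t|))).
    by rewrite mulrDr lerD// ler_wpM2r.
  rewrite /G -mulrA -mulrDr ler_wpM2l//.
  apply: (le_trans (lerD (half (h1 t)) (half (h2 t)))).
  rewrite le_eqVlt; apply/orP; left; apply/eqP.
  by field; lra.
have rF : rint (fun t => a1 t * h1 t + a2 t * h2 t).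
  apply: rint_le rG bnd.
  by apply: measurable_funD; exact: measurable_funM.
split => //; apply: (le_trans (rI_norm rF)).
apply: (@le_trans _ _ (rI G)).
  by apply: rI_le => //; exact: rint_norm.
rewrite rI_D; [|exact: rint_cst|exact: rintZ].
rewrite rI_cst rI_Z//.
have -> : M * (2 * pi + 1) * e = 2 * pi * (M * e) + M * e by ring.
rewrite lerD2l -mulrA ler_wpM2l// mulrC ler_pdivrMr ?mulr_gt0//.
by apply: (le_trans he); rewrite mulrCA -expr2; have := sqr_ge0 e; lra.
Qed.

Lemma inner_bound g h (M e : R) : ccont (fun t => g (expi t)) ->
  (forall t : R, 0 <= t <= 2 * pi ->
     `|Re (g (expi t))| <= M /\ `|Im (g (expi t))| <= M) ->
  L2 h -> L2norm h < e ->
  cint (fun t => g (expi t) * ((h (expi t))^*)%C) /\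
  `|Re (inner g h)| <= M * (2 * pi + 1) * e /\
  `|Im (inner g h)| <= M * (2 * pi + 1) * e.
Proof.
move=> [cg1 cg2] gM [mh1 mh2 rh] he.
have e0 : 0 < e by apply: le_lt_trans he; rewrite sqrtr_ge0.
have hI : rI (sqmod h) <= e ^+ 2.
  have h0 : 0 <= rI (sqmod h) by apply: rI_ge0 => t; exact: sqmod_ge0.
  by rewrite -(sqr_sqrtr h0) -L2normE ler_sqr ?nnegrE ?sqrtr_ge0 ?ltW.
have mg1 := measurable_cont cg1; have mg2 := measurable_cont cg2.
have mg1N : measurable_fun D (fun t => - Re (g (expi t))).
  exact: measurable_funN.
have [r1 b1] := bounded_pairing mg1 mg2 gM mh1 mh2 rh e0 hI.
have gM' (t : R) : 0 <= t <= 2 * pi ->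
     `|Im (g (expi t))| <= M /\ `|- Re (g (expi t))| <= M.
  by move=> /gM[? ?]; rewrite normrN.
have [r2 b2] := bounded_pairing mg2 mg1N gM' mh1 mh2 rh e0 hI.
have E1 : (fun t : R => Re (g (expi t) * ((h (expi t))^*)%C)) =
    fun t => Re (g (expi t)) * Re (h (expi t)) + Im (g (expi t)) * Im (h (expi t)).
  by apply/funext => t; rewrite cReM cReJ cImJ mulrN opprK.
have E2 : (fun t : R => Im (g (expi t) * ((h (expi t))^*)%C)) =
    fun t => Im (g (expi t)) * Re (h (expi t)) - Re (g (expi t)) * Im (h (expi t)).
  by apply/funext => t; rewrite cImM cReJ cImJ mulrN addrC.
split; first by rewrite /cint E1 E2; split=> //; under eq_fun do rewrite -mulNr.
rewrite /inner circle_integralE /cI E1 E2 /=; split => //.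
by under eq_fun do rewrite -mulNr.
Qed.

Lemma ccont_sum (I : Type) (r : seq I) (F : I -> R -> R[i]) :
  (forall i, ccont (F i)) -> ccont (fun t => \sum_(i <- r) F i t).
Proof.
move=> cF; elim: r => [|i r IH].
  by under eq_fun do rewrite big_nil; exact: ccont_cst.
by under eq_fun do rewrite big_cons; exact: ccontD.
Qed.

Lemma inner_sumr g n (c : 'I_n -> R[i]) (h : 'I_n -> circle R -> R[i]) :
  ccont (fun t => g (expi t)) -> (forall i, ccont (fun t => h i (expi t))) ->
  inner g (fun l => \sum_(i < n) c i * h i l) =
  \sum_(i < n) (c i)^*%C * inner g (h i).
Proof.
move=> cg ch; rewrite /inner circle_integralE.
have cgh i : ccont (fun t => g (expi t) * ((h i (expi t))^*)%C).
  by apply: ccontM cg (ccontJ (ch i)).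
have -> : (fun t : R => g (expi t) * ((\sum_(i < n) c i * h i (expi t))^*)%C) =
    fun t => \sum_(i < n) (c i)^*%C * (g (expi t) * ((h i (expi t))^*)%C).
  apply/funext => t; rewrite rmorph_sum mulr_sumr; apply: eq_bigr => i _.
  by rewrite rmorphM mulrCA.
rewrite (cI_sum _ (fun i => cintZ _ (ccont_cint (cgh i)))).2.
by apply: eq_bigr => i _; rewrite cI_Z//; exact: ccont_cint.
Qed.

(** A continuous function is bounded, so pairing with it is continuous for the
    L2 norm, and its vanishing extends from A to the closed span. *)
Lemma closed_span_orth (A : set (circle R -> R[i])) g w :
  ccont (fun t => g (expi t)) ->
  (forall a, A a -> ccont (fun t => a (expi t)) /\ inner g a = 0) ->
  closed_span A w -> inner g w = 0.
Proof.
move=> cg hA [L2w apx].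
have [M M0 gM] : exists2 M : R, 0 <= M & forall t : R, 0 <= t <= 2 * pi ->
     `|Re (g (expi t))| <= M /\ `|Im (g (expi t))| <= M.
  have [M1 M10 h1] := cont_bounded cg.1; have [M2 M20 h2] := cont_bounded cg.2.
  exists (M1 + M2); first exact: addr_ge0.
  by move=> t t01; split; [rewrite (le_trans (h1 _ t01)) ?lerDl|
           rewrite (le_trans (h2 _ t01)) ?lerDr].
have key (e : R) : 0 < e -> `|Re (inner g w)| <= M * (2 * pi + 1) * e /\
    `|Im (inner g w)| <= M * (2 * pi + 1) * e.
  move=> e0; have [p [n [c [h [Ah pE]]]] wp] := apx e e0.
  have ch i : ccont (fun t => h i (expi t)) by have [] := hA _ (Ah i).
  have cp : ccont (fun t => p (expi t)).
    rewrite pE; apply: ccont_sum => i.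
    by apply: ccontM (ch i); exact: ccont_cst.
  have gp : inner g p = 0.
    rewrite pE inner_sumr// big1// => i _.
    by rewrite (hA _ (Ah i)).2 mulr0.
  have [ci [b1 b2]] := inner_bound cg gM (L2B L2w (L2_ccont cp)) wp.
  suff -> : inner g w = inner g (fun l => w l - p l) by split.
  rewrite -[RHS]add0r -gp /inner !circle_integralE -cI_D//.
    congr cI; apply/funext => t.
    by rewrite -mulrDr -rmorphD /= addrC subrK.
  exact/ccont_cint/ccontM/ccontJ.
have K0 : 0 <= M * (2 * pi + 1) by rewrite mulr_ge0// addr_ge0// mulr_ge0 ?pi_ge0.
have small (x : R) : (forall e, 0 < e -> `|x| <= M * (2 * pi + 1) * e) -> x = 0.
  move=> hx; apply/eqP; rewrite -normr_le0; apply/ler_addgt0Pr => e e0.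
  rewrite add0r; set K := M * _ in K0 hx.
  have K1 : 0 < K + 1 by lra.
  apply: (le_trans (hx (e / (K + 1)) (divr_gt0 e0 K1))).
  by rewrite mulrA ler_pdivrMr//; nra.
by apply: complex_ext; apply: small => e /key[].
Qed.

End L2.

(** * Limits of functions and of their derivatives *)

Section LimitLemmas.
Variable R : realType.

Lemma telescope_tail (a : nat -> R) (M : R) :
  (forall n, `|a n| <= M * (n.+1%:R^-1 - n.+2%:R^-1)) ->
  forall N m, (N <= m)%N ->
  `|\sum_(N <= n < m) a n| <= M / N.+1%:R.
Proof.
move=> aM N m Nm.
have M0 : 0 <= M.
  have h : 0 < 1 - 2^-1 :> R by lra.
  have := aM 0%N; rewrite invr1 => /(le_trans (normr_ge0 _)).
  by rewrite pmulr_lge0.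
apply: (le_trans (ler_norm_sum _ _ _)).
apply: (@le_trans _ _ (\sum_(N <= n < m) M * (n.+1%:R^-1 - n.+2%:R^-1))).
  by apply: ler_sum => n _; exact: aM.
rewrite -mulr_sumr ler_wpM2l//.
rewrite (_ : \sum_(N <= i < m) _ =
    - (\sum_(N <= i < m) ((i.+1).+1%:R^-1 - i.+1%:R^-1))); last first.
  by rewrite -sumrN; apply: eq_bigr => i _; rewrite opprB.
rewrite (telescope_sumr (fun i => i.+1%:R^-1 : R))// opprB.
by rewrite gerBl invr_ge0.
Qed.

(** The bound is a telescoping form of O(1 / n^2), chosen because its tails can
    be summed exactly. *)
Lemma telescope_cvg (a : nat -> R) (M : R) :
  (forall n, `|a n| <= M * (n.+1%:R^-1 - n.+2%:R^-1)) ->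
  cvg (series a @ \oo) /\
  forall N, `|limn (series a) - series a N| <= M / N.+1%:R.
Proof.
move=> aM.
have ca : cvg (series a @ \oo).
  apply: normed_cvg; apply: nondecreasing_is_cvgn.
    by apply: nondecreasing_series => n _ _; exact: normr_ge0.
  exists M => _ [n _ <-].
  have aM' k : `| `|a k| | <= M * (k.+1%:R^-1 - k.+2%:R^-1).
    by rewrite normr_id.
  have := telescope_tail aM' (leq0n n); rewrite divr1.
  by apply: le_trans; exact: ler_norm.
split => // N; rewrite ler_distl.
have bnd m : (N <= m)%N -> `|series a m - series a N| <= M / N.+1%:R.
  by move=> Nm; rewrite sub_series Nm; exact: telescope_tail.
apply/andP; split.
- apply: limr_ge => //; near=> m; have Nm : (N <= m)%N by near: m; exists N.
  by have := bnd m Nm; rewrite ler_distl => /andP[].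
- apply: limr_le => //; near=> m; have Nm : (N <= m)%N by near: m; exists N.
  by have := bnd m Nm; rewrite ler_distl => /andP[].
Unshelve. all: by end_near.
Qed.

Lemma MVT_dist (f f' : R -> R) (x y : R) :
  (forall t, is_derive t (1 : R) f (f' t)) ->
  exists2 c : R, `|c - y| <= `|x - y| & f x - f y = f' c * (x - y).
Proof.
move=> df; have cf a b : {within `[a, b], continuous f}.
  apply: continuous_subspaceT => z.
  by apply/differentiable_continuous/derivable1_diffP; have [] := df z.
have [yx|/ltW xy] := leP y x.
  have [c] := MVT_segment yx (fun z _ => df z) (cf _ _).
  rewrite in_itv /= => /andP[yc cx] e; exists c => //.
  by rewrite !ger0_norm ?subr_ge0// lerD2r.
have [c] := MVT_segment xy (fun z _ => df z) (cf _ _).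
rewrite in_itv /= => /andP[xc cy] e; exists c.
  by rewrite !ler0_norm ?subr_le0// lerN2 lerD2r.
by rewrite -opprB e -mulrN opprB.
Qed.

Lemma is_derive_quadratic (f : R -> R) (t d B : R) :
  (forall h, `|f (t + h) - f t - d * h| <= B * h ^+ 2) ->
  is_derive t (1 : R) f d.
Proof.
move=> fB.
have B0 : 0 <= B.
  by have := le_trans (normr_ge0 _) (fB 1); rewrite expr1n mulr1.
have cv : (fun h : R => h^-1 *: (f (h *: 1 + t) - f t)) @ 0^' --> d.
  apply/cvgrPdist_le => e e0; near=> h.
  have h0 : h != 0 by near: h; exact: nbhs_dnbhs_neq.
  have he : `|h| <= e / (B + 1).
    near: h; apply: dnbhs0_le; rewrite divr_gt0//; lra.
  rewrite [h *: 1]mulr1 [h + t]addrC.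
  have -> : d - h^-1 *: (f (t + h) - f t) =
      - (h^-1 * (f (t + h) - f t - d * h)).
    by rewrite -[_ *: _]/(_ * _); field.
  rewrite normrN normrM normfV mulrC ler_pdivrMr ?normr_gt0//.
  apply: (le_trans (fB h)); rewrite -[h ^+ 2]real_normK ?num_real// expr2 mulrA.
  rewrite ler_wpM2r// -[e](@divfK _ (B + 1)); last by rewrite gt_eqF; lra.
  rewrite mulrC; have h1 := normr_ge0 h; nra.
apply: DeriveDef; first by apply/cvg_ex; exists d.
exact: cvg_lim.
Unshelve. all: by end_near.
Qed.

(** A uniform bound on the second derivatives makes the first order Taylor
    remainders uniformly quadratic, and this survives pointwise limits. *)
Lemma limit_is_derive (s s' s'' : nat -> R -> R) (f g : R -> R) (B : R) :
  (forall n t, is_derive t (1 : R) (s n) (s' n t)) ->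
  (forall n t, is_derive t (1 : R) (s' n) (s'' n t)) ->
  (forall n t, `|s'' n t| <= B) ->
  (forall t, (fun n => s n t) @ \oo --> f t) ->
  (forall t, (fun n => s' n t) @ \oo --> g t) ->
  forall t, is_derive t (1 : R) f (g t).
Proof.
move=> ds ds' sB sf sg t; apply: (@is_derive_quadratic _ _ _ B) => h.
have B0 : 0 <= B by apply: le_trans (sB 0%N 0).
have key n : `|s n (t + h) - s n t - s' n t * h| <= B * h ^+ 2.
  have [c] := MVT_dist (t + h) t (ds n); rewrite addrAC subrr add0r => ct ->.
  rewrite -mulrBl normrM -[h ^+ 2]real_normK ?num_real// expr2 mulrA.
  rewrite ler_wpM2r//; apply: (le_trans (is_derive_lipschitz (ds' n) (sB n) c t)).
  by rewrite ler_wpM2l.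
have cv : (fun n => `|s n (t + h) - s n t - s' n t * h|) @ \oo -->
    `|f (t + h) - f t - g t * h|.
  apply: cvg_norm; apply: cvgB; first by apply: cvgB.
  by apply: cvgM => //; exact: cvg_cst.
rewrite -(cvg_lim (@Rhausdorff R) cv); apply: limr_le.
  by apply/cvg_ex; eexists; exact: cv.
by near=> n; exact: key.
Unshelve. all: by end_near.
Qed.

End LimitLemmas.

(** * Fourier series with rapidly decreasing coefficients *)

Section Synthesis.
Variable R : realType.
Implicit Types (c : nat -> R[i]) (l : circle R).

Definition rapid c := forall k : nat, exists M : R,
  forall n, normc (c n) * n.+1%:R ^+ k <= M.

Definition fterm c n l : R[i] := c n * ek (2 * n)%N l.

Definition fpart c N l : R[i] := \sum_(0 <= n < N) fterm c n l.

Definition fsum c l : R[i] :=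
  limn (series (fun n => Re (fterm c n l))) +i*
  limn (series (fun n => Im (fterm c n l))).

(** The coefficients of the differentiated series. *)
Definition cdiff c n : R[i] := 'i%C * ((2 * n)%N%:R * c n).

Lemma normc_ge0 (z : R[i]) : 0 <= normc z.
Proof. by case: z => a b; exact: sqrtr_ge0. Qed.

Lemma rapid_diff c : rapid c -> rapid (cdiff c).
Proof.
move=> rc k; have [M cM] := rc k.+1; exists (2 * M) => n.
rewrite /cdiff !normcM normc_nat.
have -> : normc 'i%C = 1 :> R by rewrite /= expr0n /= expr1n add0r sqrtr1.
rewrite mul1r; apply: (@le_trans _ _ (2 * (normc (c n) * n.+1%:R ^+ k.+1))).
  rewrite exprS [X in _ <= X](_ : _ = 2 * n.+1%:R * normc (c n) * n.+1%:R ^+ k).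
    rewrite ler_wpM2r ?exprn_ge0// ler_wpM2r ?normc_ge0//.
    by rewrite natrM ler_wpM2l// ler_nat.
  by ring.
by rewrite ler_wpM2l.
Qed.

Lemma rapid_bound c : rapid c -> exists2 M : R, 0 <= M &
  forall n, normc (c n) <= M * (n.+1%:R^-1 - n.+2%:R^-1).
Proof.
move=> /(_ 2%N)[M cM]; exists (2 * M).
  rewrite mulr_ge0//; apply: le_trans (cM 0%N).
  by rewrite mulr_ge0 ?normc_ge0 ?exprn_ge0.
move=> n; have h1 : 0 < n.+1%:R :> R by rewrite ltr0n.
have h2 : 0 < n.+2%:R :> R by rewrite ltr0n.
have -> : 2 * M * (n.+1%:R^-1 - n.+2%:R^-1) = 2 * M / (n.+1%:R * n.+2%:R).
  rewrite -[n.+2%:R]natr1; move: h1; set x := n.+1%:R => h1.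
  by field; apply/andP; split; lra.
rewrite ler_pdivlMr ?mulr_gt0//.
apply: le_trans (ler_wpM2l _ (cM n)) => //.
have -> : 2 * (normc (c n) * n.+1%:R ^+ 2) =
    normc (c n) * (n.+1%:R * (2 * n.+1%:R)) by ring.
rewrite ler_wpM2l ?normc_ge0// ler_wpM2l ?(ltW h1)//.
by rewrite -natrM ler_nat; lia.
Qed.

Lemma Re_fpart c N l : Re (fpart c N l) = series (fun n => Re (fterm c n l)) N.
Proof. exact: Re_sum. Qed.

Lemma Im_fpart c N l : Im (fpart c N l) = series (fun n => Im (fterm c n l)) N.
Proof. exact: Im_sum. Qed.

Lemma normc_fterm c n l : normc (fterm c n l) = normc (c n).
Proof. by rewrite normcM normc_ek mulr1. Qed.

(** Already a decay in 1 / n^2 makes the partial sums converge uniformly, at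
    the rate 1 / N. *)
Lemma fsum_tail c : rapid c -> exists2 M : R, 0 <= M & forall l,
  [/\ (fun N => Re (fpart c N l)) @ \oo --> Re (fsum c l),
      (fun N => Im (fpart c N l)) @ \oo --> Im (fsum c l) &
      forall N, `|Re (fsum c l) - Re (fpart c N l)| <= M / N.+1%:R /\
                `|Im (fsum c l) - Im (fpart c N l)| <= M / N.+1%:R].
Proof.
move=> /rapid_bound[M M0 cM]; exists M => // l.
have hR n : `|Re (fterm c n l)| <= M * (n.+1%:R^-1 - n.+2%:R^-1).
  by apply: le_trans (cM n); rewrite -(normc_fterm c n l); exact: abs_Re_le.
have hI n : `|Im (fterm c n l)| <= M * (n.+1%:R^-1 - n.+2%:R^-1).
  by apply: le_trans (cM n); rewrite -(normc_fterm c n l); exact: abs_Im_le.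
have [cR tR] := telescope_cvg hR; have [cI tI] := telescope_cvg hI.
split.
- by under eq_fun do rewrite Re_fpart; exact: cR.
- by under eq_fun do rewrite Im_fpart; exact: cI.
- by move=> N; rewrite Re_fpart Im_fpart; split; [exact: tR|exact: tI].
Qed.

Lemma fpart_bounded c : rapid c -> exists M : R, forall N l,
  `|Re (fpart c N l)| <= M /\ `|Im (fpart c N l)| <= M.
Proof.
move=> /fsum_tail[M M0 h]; exists (2 * M) => N l; have [_ _ t] := h l.
have {t} [[] ] := (t 0%N, t N); rewrite divr1 /fpart big_geq//=.
rewrite !subr0 => r0 i0 [rN iN].
have MN : M / N.+1%:R <= M by rewrite ler_pdivrMr// ler_peMr// ler1n.
split.
- rewrite -[X in `|X|](subKr (Re (fsum c l))).
  apply: (le_trans (ler_normB _ _)).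
  have := le_trans rN MN; lra.
- rewrite -[X in `|X|](subKr (Im (fsum c l))).
  apply: (le_trans (ler_normB _ _)).
  have := le_trans iN MN; lra.
Qed.

Lemma cder_fpart c N :
  cder (fun t => fpart c N (expi t)) (fun t => fpart (cdiff c) N (expi t)).
Proof.
apply: cder_sum => n; apply: eq_cder (cderZ (c n) (cder_ek (2 * n)%N)) _ _ => t //.
by rewrite /fterm /cdiff -pmulrn; ring.
Qed.

(** Termwise differentiation: the twice differentiated series still decreases
    rapidly, which bounds the second derivatives of the partial sums. *)
Lemma cder_fsum c : rapid c ->
  cder (fun t => fsum c (expi t)) (fun t => fsum (cdiff c) (expi t)).
Proof.
move=> rc; have rc1 := rapid_diff rc.
have [B cB] := fpart_bounded (rapid_diff rc1).
have [M _ hM] := fsum_tail rc; have [M1 _ hM1] := fsum_tail rc1.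
move=> t; split.
- apply: (@limit_is_derive R (fun n x => Re (fpart c n (expi x)))
    (fun n x => Re (fpart (cdiff c) n (expi x)))
    (fun n x => Re (fpart (cdiff (cdiff c)) n (expi x)))
    (fun x => Re (fsum c (expi x))) (fun x => Re (fsum (cdiff c) (expi x))) B).
  + by move=> n x; have [] := cder_fpart c n x.
  + by move=> n x; have [] := cder_fpart (cdiff c) n x.
  + by move=> n x; have [] := cB n (expi x).
  + by move=> x; have [] := hM (expi x).
  + by move=> x; have [] := hM1 (expi x).
- apply: (@limit_is_derive R (fun n x => Im (fpart c n (expi x)))
    (fun n x => Im (fpart (cdiff c) n (expi x)))
    (fun n x => Im (fpart (cdiff (cdiff c)) n (expi x)))
    (fun x => Im (fsum c (expi x))) (fun x => Im (fsum (cdiff c) (expi x))) B).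
  + by move=> n x; have [] := cder_fpart c n x.
  + by move=> n x; have [] := cder_fpart (cdiff c) n x.
  + by move=> n x; have [] := cB n (expi x).
  + by move=> x; have [] := hM (expi x).
  + by move=> x; have [] := hM1 (expi x).
Qed.

Lemma smooth_fsum c : rapid c -> smooth (fsum c).
Proof.
move=> rc; apply/Ck_smooth => n; elim: n c rc => [//|n IH] c rc.
exists (fun t => fsum (cdiff c) (expi t)); first exact: cder_fsum.
exact/IH/rapid_diff.
Qed.

Lemma smooth_fpart c N : smooth (fpart c N).
Proof. by apply: smooth_sum => n; apply: smoothZ; exact: smooth_ek. Qed.

Definition even_modes : set (circle R -> R[i]) :=
  [set fun l : circle R => val l ^+ (2 * n) | n in setT].

(** Uniform convergence on the circle implies convergence in L2. *)
Lemma fsum_closed_span c : rapid c -> closed_span even_modes (fsum c).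
Proof.
move=> rc; have sc := smooth_fsum rc; split; first exact: L2_smooth.
have [M M0 hM] := fsum_tail rc => e e0.
pose N := Num.truncn (4 * M / e).
have hN : 4 * M / e < N.+1%:R by exact: Num.Theory.truncnS_gt.
exists (fpart c N).
  exists N, (fun i => c i), (fun i l => val l ^+ (2 * i)); split.
    by move=> i; exists (val i).
  by apply/funext => l; rewrite /fpart big_mkord.
have d0 : 0 <= M / N.+1%:R by rewrite divr_ge0.
have d1 : 4 * (M / N.+1%:R) < e.
  by rewrite mulrA ltr_pdivrMr ?ltr0n// -ltr_pdivrMl// mulrC.
set d := M / N.+1%:R in d0 d1.
rewrite L2normE -(gtr0_norm e0) -sqrtr_sqr ltr_sqrt ?exprn_gt0//.
have sd : smooth (fun l => fsum c l - fpart c N l).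
  have := smoothD sc (smoothZ (-1) (smooth_fpart c N)).
  by congr smooth; apply/funext => l; rewrite mulN1r.
apply: (@le_lt_trans _ _ (rI (fun=> 2 * d ^+ 2))).
  apply: rI_le.
  - exact: (rint_cont (continuous_sqmod (smooth_ccont sd))).
  - exact: rint_cst.
  move=> t _; have [_ _ /(_ N)] := hM (expi t).
  rewrite /sqmod !(cReD, cImD, cReN, cImN) -/d => -[h1 h2].
  rewrite -[X in X + _]real_normK ?num_real// -[X in _ + X]real_normK ?num_real//.
  rewrite mulr_natl mulr2n lerD//.
  - by rewrite ler_sqr ?nnegrE.
  - by rewrite ler_sqr ?nnegrE.
rewrite rI_cst; have := pihalf_lt2 R; have p0 := pi_gt0 R => p4.
have pp : pi < 4 :> R by lra.
have d2 := sqr_ge0 d.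
(* 4 pi d^2 <= 16 d^2 < e^2 *)
apply: (@le_lt_trans _ _ ((4 * d) ^+ 2)); first by nra.
by rewrite ltr_sqr ?nnegrE ?mulr_ge0// ltW.
Qed.

Lemma rI_small (f : R -> R) (d : R) : rint f ->
  (forall t, 0 <= t <= 2 * pi -> `|f t| <= d) -> `|rI f| <= 2 * pi * d.
Proof.
move=> rf fd; apply: (le_trans (rI_norm rf)); rewrite -rI_cst.
by apply: rI_le => //; [exact: rint_norm|exact: rint_cst].
Qed.

Lemma fc_bound (f : circle R -> R[i]) (M : R) k : smooth f ->
  (forall l, `|Re (f l)| <= M /\ `|Im (f l)| <= M) ->
  `|Re (fc f k)| <= 2 * pi * (2 * M) /\ `|Im (fc f k)| <= 2 * pi * (2 * M).
Proof.
move=> sf fM; rewrite fcE /cI /=; have [r1 r2] := fc_cint k sf.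
have eb (l : circle R) (j : int) : `|Re (ek j l)| <= 1 /\ `|Im (ek j l)| <= 1.
  by rewrite -(normc_ek j l); split; [exact: abs_Re_le|exact: abs_Im_le].
have pb (x y M' : R) : `|x| <= M' -> `|y| <= 1 -> `|x * y| <= M'.
  by move=> h1 h2; rewrite normrM -[M']mulr1 ler_pM.
split; apply: rI_small => // t _; have [m1 m2] := fM (expi t);
  have [e1 e2] := eb (expi t) (- k); rewrite ?cReM ?cImM.
- apply: (le_trans (ler_normB _ _)).
  by rewrite mulr_natl mulr2n lerD// pb.
- apply: (le_trans (ler_normD _ _)).
  by rewrite mulr_natl mulr2n lerD// pb.
Qed.

Lemma small_eq0 (x K : R) : (forall N, `|x| <= K / N.+1%:R) -> x = 0.
Proof.
move=> h; apply/eqP; rewrite -normr_le0; apply/ler_addgt0Pr => e e0.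
rewrite add0r; pose N := Num.truncn (K / e).
have hN : K / e < N.+1%:R by exact: Num.Theory.truncnS_gt.
apply: (le_trans (h N)); rewrite ler_pdivrMr ?ltr0n//.
by rewrite mulrC -ler_pdivrMr// ltW.
Qed.

(** Fourier coefficients are continuous for uniform convergence. *)
Lemma fc_fsum_eq c k (z : R[i]) N0 : rapid c ->
  (forall N, (N0 <= N)%N -> fc (fpart c N) k = z) -> fc (fsum c) k = z.
Proof.
move=> rc hz; have sc := smooth_fsum rc.
have [M M0 hM] := fsum_tail rc.
have key N : `|Re (fc (fsum c) k - z)| <= 2 * pi * (2 * M) / N.+1%:R /\
    `|Im (fc (fsum c) k - z)| <= 2 * pi * (2 * M) / N.+1%:R.
  pose N' := maxn N0 N.
  have sp := smooth_fpart c N'; have sn := smoothZ (-1) sp.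
  have -> : fc (fsum c) k - z = fc (fun l => fsum c l + (-1) * fpart c N' l) k.
    by rewrite (fcD _ sc sn) (fcZ _ _ sp) hz ?leq_maxl// mulN1r.
  have := @fc_bound (fun l => fsum c l + (-1) * fpart c N' l) (M / N.+1%:R) k
    (smoothD sc sn).
  rewrite !mulrA; apply=> l; have [_ _ /(_ N')[h1 h2]] := hM l.
  have mm : M / N'.+1%:R <= M / N.+1%:R.
    by rewrite ler_wpM2l// lef_pV2 ?posrE ?ltr0n// ler_nat ltnS leq_maxr.
  rewrite mulN1r !(cReD, cImD, cReN, cImN).
  by split; [exact: le_trans h1 mm|exact: le_trans h2 mm].
apply/eqP; rewrite -subr_eq0; apply/eqP; apply: complex_ext.
- by apply: (@small_eq0 _ (2 * pi * (2 * M))) => N; have [] := key N.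
- by apply: (@small_eq0 _ (2 * pi * (2 * M))) => N; have [] := key N.
Qed.

Lemma fc_fpart c N k :
  fc (fpart c N) k = \sum_(0 <= n < N) c n * ((2 * pi)%:C *+ ((2 * n)%N%:Z == k)).
Proof.
rewrite /fpart fc_sum; last by move=> n; apply: smoothZ; exact: smooth_ek.
by apply: eq_bigr => n _; rewrite fcZ ?fc_ek//; exact: smooth_ek.
Qed.

Lemma fc_fsum_even c m : rapid c -> fc (fsum c) (2 * m)%N = (2 * pi)%:C * c m.
Proof.
move=> rc; apply: (fc_fsum_eq (N0 := m.+1)) rc _ => N mN.
rewrite fc_fpart (bigD1_seq m) ?mem_index_iota ?iota_uniq//=.
rewrite eqxx mulr1n big1 ?addr0 1?mulrC// => n nm.
by rewrite eqz_nat eqn_pmul2l// (negPf nm) mulr0n mulr0.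
Qed.

Lemma fc_fsum_other c k : rapid c -> (forall n : nat, k != (2 * n)%N%:Z) ->
  fc (fsum c) k = 0.
Proof.
move=> rc hk; apply: (fc_fsum_eq (N0 := 0%N)) rc _ => N _.
rewrite fc_fpart big1// => n _.
by rewrite eq_sym (negPf (hk n)) mulr0n mulr0.
Qed.

(** The k-th derivative of f has bounded Fourier coefficients, and these are
    those of f multiplied by the k-th power of the frequency. *)
Lemma rapid_fc (f : circle R -> R[i]) : smooth f ->
  rapid (fun n => ((2 * pi)^-1)%:C * fc f (2 * n)%N).
Proof.
move=> sf k.
have bnd g : smooth g -> exists M : R, forall n, normc (fc g (2 * n)%N) <= M.
  move=> sg; have [M M0 gM] := smooth_bounded sg.
  exists (2 * pi * (2 * M) + 2 * pi * (2 * M)) => n.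
  have [h1 h2] := fc_bound (2 * n)%N sg gM.
  by apply: (le_trans (normc_le_abs _)); exact: lerD.
(* M0 takes care of the frequency 0, where derivatives give no information. *)
have [M0 h0] := bnd _ sf.
have [M1 h1] := bnd _ (smooth_iter_Dtheta k sf).
pose K := normc ((2 * pi)^-1)%:C : R.
exists (K * (M0 + M1)) => n; rewrite normcM -/K -mulrA ler_wpM2l ?normc_ge0//.
have {}h0 := h0 n; have {}h1 := h1 n.
have M0p : 0 <= M0 by apply: le_trans h0; exact: normc_ge0.
have M1p : 0 <= M1 by apply: le_trans h1; exact: normc_ge0.
case: n h0 h1 => [|n] h0 h1; first by rewrite expr1n mulr1 (le_trans h0)// lerDl.
apply: (@le_trans _ _ M1); last by rewrite lerDr.
apply: le_trans h1; rewrite fc_iter_Dtheta// normcM mulrC ler_wpM2r ?normc_ge0//.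
have -> : normc ((2 * n.+1)%N%:~R ^+ k : R[i]) = (2 * n.+1)%N%:R ^+ k.
  by rewrite -pmulrn -(natrX R[i]) normc_nat natrX.
by rewrite lerXn2r ?nnegrE// ler_nat; lia.
Qed.

End Synthesis.

(** * The even projection as a Fourier multiplier *)

Section SzegoProjection.
Variable R : realType.
Implicit Types (u v f g : circle R -> R[i]).

Definition even_ge0 (k : int) : bool := if k is Posz n then ~~ odd n else false.

Lemma even_ge0P k : reflect (exists n : nat, k = (2 * n)%N%:Z) (even_ge0 k).
Proof.
case: k => n /=; last by apply: ReflectF => -[].
apply: (iffP idP) => [en|[m [->]]]; last by rewrite mul2n odd_double.
by exists n./2; rewrite mul2n even_halfK.
Qed.

Lemma cI_conj (F : R -> R[i]) : cint F ->
  cI (fun t => ((F t)^*)%C) = ((cI F)^*)%C.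
Proof.
move=> [_ b]; apply: complex_ext; rewrite /cI /=.
  by congr rI; apply/funext => t; rewrite cReJ.
under eq_fun do rewrite cImJ -mulN1r.
by rewrite rI_Z// mulN1r.
Qed.

Lemma inner_conj f g : smooth f -> smooth g -> inner f g = ((inner g f)^*)%C.
Proof.
move=> /smooth_ccont sf /smooth_ccont sg.
rewrite /inner !circle_integralE -cI_conj.
  congr cI; apply/funext => t.
  by rewrite rmorphM /= conjcK mulrC.
by apply/ccont_cint/ccontM => //; exact: ccontJ.
Qed.

Lemma even_modes_ek (a : circle R -> R[i]) : even_modes a ->
  exists n : nat, a = ek (2 * n)%N.
Proof. by move=> [n _ <-]; exists n. Qed.

Lemma L2norm0 : L2norm (fun _ : circle R => 0) = 0.
Proof.
rewrite L2normE (_ : sqmod _ = fun=> 0); first by rewrite rI_cst mulr0 sqrtr0.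
by apply/funext => t; rewrite /sqmod /= expr0n addr0.
Qed.

Lemma closed_span_mode (n : nat) :
  closed_span (@even_modes R) (ek (2 * n)%N).
Proof.
split; first exact/L2_smooth/smooth_ek.
move=> e e0; exists (ek (2 * n)%N).
  exists 1%N, (fun=> 1), (fun=> ek (2 * n)%N); split; first by move=> _; exists n.
  by apply/funext => l; rewrite big_ord1 mul1r.
rewrite (_ : (fun l => _) = fun=> 0) ?L2norm0//.
by apply/funext => l; rewrite subrr.
Qed.

Lemma fcB f g k : smooth f -> smooth g ->
  fc (fun l => f l - g l) k = fc f k - fc g k.
Proof.
move=> sf sg; rewrite -[fc g k]mul1r -mulNr -(fcZ _ _ sg).
rewrite -(fcD _ sf (smoothZ _ sg)); congr fc; apply/funext => l.
by rewrite mulN1r.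
Qed.

Lemma smoothB f g : smooth f -> smooth g -> smooth (fun l => f l - g l).
Proof.
move=> sf sg; have := smoothD sf (smoothZ (-1) sg); congr smooth.
by apply/funext => l; rewrite mulN1r.
Qed.

Definition szego u : circle R -> R[i] :=
  fsum (fun n => ((2 * pi)^-1)%:C * fc u (2 * n)%N).

Lemma smooth_szego u : smooth u -> smooth (szego u).
Proof. by move=> su; exact/smooth_fsum/rapid_fc. Qed.

Lemma fc_szego u k : smooth u ->
  fc (szego u) k = if even_ge0 k then fc u k else 0.
Proof.
move=> su; have rc := rapid_fc su; case: even_ge0P => [[n ->]|nk].
  rewrite (fc_fsum_even _ rc) mulrA -rmorphM /= divff ?mul1r//.
  by rewrite mulf_neq0 ?gt_eqF ?pi_gt0.
by apply: fc_fsum_other => // n; apply/eqP => kn; apply: nk; exists n.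
Qed.

(** Testing against the modes in the closed span, and testing the modes outside
    it against the closed span, gives the coefficients of a projection.
    Conversely, these coefficients force v to be the Fourier series szego v,
    which lies in the closed span, and make u - v orthogonal to it. *)
Lemma Pi_evenP u v : smooth u -> smooth v ->
  Pi_even u v <-> forall k, fc v k = if even_ge0 k then fc u k else 0.
Proof.
move=> su sv; split.
- move=> [_ Kv orth] k; case: even_ge0P => [[n ->]|nk].
    have := orth _ (closed_span_mode n).
    by rewrite -/(fc _ _) (fcB _ su sv) => /eqP; rewrite subr_eq0 => /eqP.
  rewrite /fc (inner_conj sv (smooth_ek k)).
  rewrite (closed_span_orth _ _ Kv) ?conjc0//; first exact: ccont_ek.
  move=> a /even_modes_ek[n ->]; split; first exact: ccont_ek.
  rewrite -/(fc _ _) fc_ek; case: eqP => // kn; case: nk; by exists n.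
- move=> vk.
  have vE : v = szego v.
    apply: (fc_inj sv (smooth_szego sv)).
    by move=> k; rewrite (fc_szego k sv) vk; case: ifP.
  split; first exact: L2_smooth.
    by rewrite vE; apply: fsum_closed_span; exact: rapid_fc.
  move=> w; apply: (closed_span_orth (smooth_ccont (smoothB su sv))).
  move=> a /even_modes_ek[n ->]; split; first exact: ccont_ek.
  rewrite -/(fc _ _) (fcB _ su sv) vk; case: even_ge0P => [_|[]]; first by rewrite subrr.
  by exists n.
Qed.

End SzegoProjection.

(** * Differential operators commuting with the even projection *)

Section CommutingOperators.
Variable R : realType.
Implicit Types (u v f : circle R -> R[i]).

Lemma even_ge0E (k : int) : even_ge0 k = (0 <= k) && ((k %% 2)%Z == 0).
Proof.
case: k => n //=.
by rewrite modz_nat eqz_nat modn2 eqb0.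
Qed.

(** The integers n of which exactly one of n and n + 2m is even and nonnegative,
    enumerated by i < |m|: -2, -4, ..., -2m if m > 0 and 0, 2, ..., -2m - 2 if
    m < 0. *)
Definition crossing (m : int) (i : nat) : int :=
  if m is Posz _ then - (2 * i.+1)%N%:Z else (2 * i)%N%:Z.

Lemma crossingP (m n : int) : even_ge0 n != even_ge0 (n + 2 * m) ->
  exists2 i, (i < `|m|)%N & n = crossing m i.
Proof.
rewrite !even_ge0E.
case: m => a h /=.
- exists (`|n|./2 - 1)%N; last first; lia.
- exists (`|n|./2)%N; last first; lia.
Qed.

Lemma crossing_even_ge0 (m : int) (i : nat) : (i < `|m|)%N ->
  even_ge0 (crossing m i) != even_ge0 (crossing m i + 2 * m).
Proof. by rewrite !even_ge0E; case: m => a /=; lia. Qed.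

Lemma crossing_inj m : injective (crossing m).
Proof. by case: m => a i j /=; lia. Qed.

Lemma fc_diffop_mode (p : {poly R[i]}) d m u k : (size p <= d.+1)%N ->
  smooth u ->
  fc (diffop d (fun r l => p`_r * ek m l) u) k =
  p.[(k - m)%:~R] * fc u (k - m).
Proof.
move=> sp su.
have sr r : smooth (fun l => p`_r * (iter r (@Dtheta R) u l * ek m l)).
  by apply/smoothZ/smoothM; [exact: smooth_iter_Dtheta|exact: smooth_ek].
have -> : diffop d (fun r l => p`_r * ek m l) u =
    fun l => \sum_(r < d.+1) p`_r * (iter r (@Dtheta R) u l * ek m l).
  apply/funext => l; apply: eq_bigr => r _.
  by rewrite -mulrA [ek m l * _]mulrC.
rewrite (fc_sum _ _ (fun r : 'I_d.+1 => sr r)) (horner_coef_wide _ sp) mulr_suml.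
apply: eq_bigr => r _; rewrite fcZ; last first.
  by apply: smoothM; [exact: smooth_iter_Dtheta|exact: smooth_ek].
by rewrite fcM_ek (fc_iter_Dtheta _ _ su) mulrA.
Qed.

(** The operator e_m p(D) maps e_n to p(n) e_(n+m), so vanishing of p at the
    crossing frequencies is exactly what keeps the range and the kernel of the
    projection stable. *)
Lemma commutes_mode (p : {poly R[i]}) d m : (size p <= d.+1)%N ->
  (forall n, even_ge0 n != even_ge0 (n + m) -> p.[n%:~R] = 0) ->
  commutes_Pi_even (diffop d (fun r l => p`_r * ek m l)).
Proof.
move=> sp p0 u su; have sv := smooth_szego su.
have sa r : (r <= d)%N -> smooth (fun l : circle R => p`_r * ek m l).
  by move=> _; apply: smoothZ; exact: smooth_ek.
exists (szego u); first exact: sv.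
split; first by apply/(Pi_evenP su sv) => k; exact: fc_szego.
apply/(Pi_evenP (smooth_diffop sa su) (smooth_diffop sa sv)) => k.
rewrite (fc_diffop_mode _ _ sp su) (fc_diffop_mode _ _ sp sv) (fc_szego _ su).
have := p0 (k - m); rewrite subrK.
case: (even_ge0 (k - m)) (even_ge0 k) => -[] //= p0k; rewrite ?mulr0 //.
- by rewrite p0k// mul0r.
- by rewrite p0k// mul0r.
Qed.

(** The power of X serves to bring the degree up to d. *)
Definition crossing_poly (m : int) (d : nat) : {poly R[i]} :=
  (\prod_(i < `|m|) ('X - ((crossing m i)%:~R)%:P)) * 'X^(d - `|m|).

Lemma crossing_poly_monic m d : crossing_poly m d \is monic.
Proof.
by rewrite monicMr ?monicXn// monic_prod// => i _; exact: monicXsubC.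
Qed.

Lemma size_crossing_poly m d : (`|m| <= d)%N -> size (crossing_poly m d) = d.+1.
Proof.
move=> md; rewrite size_Mmonic ?monicXn//; last first.
  by apply/monic_neq0/monic_prod => i _; exact: monicXsubC.
rewrite -(big_mkord xpredT (fun i => 'X - ((crossing m i)%:~R)%:P)).
by rewrite size_polyXn size_prod_XsubC size_iota subn0 addSn addnS /= subnKC.
Qed.

Lemma crossing_poly_root m d n : even_ge0 n != even_ge0 (n + 2 * m) ->
  (crossing_poly m d).[n%:~R] = 0.
Proof.
move=> /crossingP[i im ->]; rewrite hornerM horner_prod.
by rewrite (bigD1 (Ordinal im))//= hornerXsubC subrr !mul0r.
Qed.

Lemma iter_DthetaZ (c : R[i]) f r : smooth f ->
  iter r (@Dtheta R) (fun l => c * f l) = fun l => c * iter r (@Dtheta R) f l.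
Proof.
move=> sf; elim: r => [//|r IH].
by rewrite !iterS IH (DthetaZ _ (smooth_iter_Dtheta r sf)).
Qed.

Lemma diffopZ d (a : nat -> circle R -> R[i]) (c : R[i]) f : smooth f ->
  diffop d a (fun l => c * f l) = fun l => c * diffop d a f l.
Proof.
move=> sf; apply/funext => l; rewrite /diffop mulr_sumr.
by apply: eq_bigr => r _; rewrite (iter_DthetaZ _ _ sf) mulrCA.
Qed.

(** As D e_n = n e_n, the entry of the operator between the frequencies n and k
    is polynomial in n along each diagonal k - n = constant. *)
Lemma fc_diffop_ek d (a : nat -> circle R -> R[i]) n k :
  (forall r, (r <= d)%N -> smooth (a r)) ->
  fc (diffop d a (ek n)) k = (\poly_(r < d.+1) fc (a r) (k - n)).[n%:~R].
Proof.
move=> sa.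
have sr (r : 'I_d.+1) : smooth (fun l => n%:~R ^+ r * (a r l * ek n l)).
  by apply/smoothZ/smoothM; [apply: sa; rewrite -ltnS|exact: smooth_ek].
have -> : diffop d a (ek n) =
    fun l => \sum_(r < d.+1) n%:~R ^+ r * (a r l * ek n l).
  apply/funext => l; apply: eq_bigr => r _.
  by rewrite iter_Dtheta_ek mulrCA.
rewrite (fc_sum _ _ sr) horner_poly; apply: eq_bigr => r _.
rewrite fcZ ?fcM_ek 1?mulrC//.
by apply: smoothM; [apply: sa; rewrite -ltnS|exact: smooth_ek].
Qed.

(** The projection of e_n is e_n or 0; the multiplier form of the projection of
    its image then kills every entry that joins a selected frequency to an
    unselected one. *)
Lemma commutes_coef d (a : nat -> circle R -> R[i]) n k :
  (forall r, (r <= d)%N -> smooth (a r)) -> commutes_Pi_even (diffop d a) ->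
  even_ge0 n != even_ge0 k -> fc (diffop d a (ek n)) k = 0.
Proof.
move=> sa ca nk; have se := @smooth_ek R n.
have [v sv [P1 P2]] := ca _ se.
have sD := smooth_diffop sa se.
have vE : v = fun l => (even_ge0 n)%:R * ek n l.
  apply: (fc_inj sv (smoothZ _ se)) => j.
  rewrite (iffLR (Pi_evenP se sv) P1 j) (fcZ _ _ se) fc_ek.
  case: eqP => [<-|_]; last by rewrite mulr0n mulr0; case: ifP.
  by case: (even_ge0 n); rewrite ?mul1r ?mul0r.
have := iffLR (Pi_evenP sD (smooth_diffop sa sv)) P2 k.
rewrite vE (diffopZ _ _ _ se) (fcZ _ _ sD).
by case: (even_ge0 n) (even_ge0 k) nk => -[]//= _; rewrite ?mul1r ?mul0r.
Qed.

Lemma many_roots_eq0 (p : {poly R[i]}) d (z : nat -> int) : (size p <= d.+1)%N ->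
  injective z -> (forall i, (i <= d)%N -> p.[(z i)%:~R] = 0) -> p = 0.
Proof.
move=> sp zi pz; apply/eqP/negPn/negP => p0.
have := @max_poly_roots _ p [seq (z i)%:~R | i <- iota 0 d.+1] p0.
rewrite size_map size_iota ltnNge sp => /(_ _ _)/wrap[]//.
  apply/allP => _ /mapP[i + ->]; rewrite mem_iota add0n ltnS => /andP[_ id].
  by apply/rootP; exact: pz.
by rewrite map_inj_uniq ?iota_uniq// => i j /intr_inj/zi.
Qed.

(** On the diagonal j the entries are given by a polynomial of degree at most d
    that vanishes at every frequency n separated from n + j. If j is odd, all
    even n >= 0 are such roots; if j = 2m, the roots are the |m| crossing
    frequencies, too many as soon as |m| > d. *)
Lemma symbol_support d (a : nat -> circle R -> R[i]) j :
  (forall r, (r <= d)%N -> smooth (a r)) -> commutes_Pi_even (diffop d a) ->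
  fc (a d) j != 0 ->
  exists2 i, (i <= 2 * d)%N & j = i%:Z * 2 - (2 * d)%N%:Z.
Proof.
move=> sa ca; pose P := \poly_(r < d.+1) fc (a r) j.
have vanish n : even_ge0 n != even_ge0 (n + j) -> P.[n%:~R] = 0.
  move=> h; have := fc_diffop_ek n (n + j) sa.
  rewrite [n + j - n]addrAC subrr add0r => <-.
  exact: (commutes_coef sa ca h).
have : fc (a d) j = P`_d by rewrite coef_poly ltnSn.
move=> ->; have sP : (size P <= d.+1)%N by exact: size_poly.
have [[m jm]|jo] : (exists m : int, j = 2 * m) \/ (j %% 2)%Z <> 0.
- have [h|/eqP h] := eqVneq (j %% 2)%Z 0; [left|by right].
  by exists (j %/ 2)%Z; lia.
- have [md|md] := leqP `|m| d.
    move=> _; exists `|(m + d%:Z)%R|%N; lia.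
  rewrite (_ : P = 0) ?coef0 ?eqxx//.
  apply: (many_roots_eq0 sP (@crossing_inj m)) => i id.
  by apply: vanish; rewrite jm; apply: crossing_even_ge0; lia.
- rewrite (_ : P = 0) ?coef0 ?eqxx//.
  apply: (many_roots_eq0 sP (z := fun i => (2 * i)%N%:Z)) => [i i'|i id]; first lia.
  by apply: vanish; rewrite !even_ge0E; lia.
Qed.

End CommutingOperators.

(** * Complex spans *)

Section LinearClosure.
Variables (R : realType) (T : Type).
Implicit Types (A B : set (T -> R[i])) (g h : T -> R[i]).

Definition lin_closed A := [/\ A (fun=> 0),
  forall g h, A g -> A h -> A (fun x => g x + h x) &
  forall (c : R[i]) g, A g -> A (fun x => c * g x)].

Lemma lin_closed_sum A (I : Type) (r : seq I) (c : I -> R[i])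
    (h : I -> T -> R[i]) : lin_closed A -> (forall i, c i != 0 -> A (h i)) ->
  A (fun x => \sum_(i <- r) c i * h i x).
Proof.
move=> [A0 AD AZ] Ah; elim: r => [|i r IH].
  by rewrite (_ : (fun x => _) = fun=> 0)//; apply/funext => x; rewrite big_nil.
rewrite (_ : (fun x => _) = fun x => c i * h i x + \sum_(i <- r) c i * h i x).
  apply: AD IH; have [->|ci] := eqVneq (c i) 0; last exact/AZ/Ah.
  by rewrite (_ : (fun x => _) = fun=> 0)//; apply/funext => x; rewrite mul0r.
by apply/funext => x; rewrite big_cons.
Qed.

Lemma cspan_lin_closed A : lin_closed (cspan A).
Proof.
split.
- exists 0%N, (fun=> 0), (fun=> fun=> 0); split; first by case.
  by apply/funext => x; rewrite big_ord0.
- move=> _ _ [n [c [h [Ah ->]]]] [m [c' [h' [Ah' ->]]]].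
  exists (n + m)%N,
    (fun i => match fintype.split i with inl j => c j | inr j => c' j end),
    (fun i => match fintype.split i with inl j => h j | inr j => h' j end); split.
    by move=> i; case: (fintype.split i).
  apply/funext => x; rewrite big_split_ord /=; congr (_ + _).
    by apply: eq_bigr => i _; rewrite (unsplitK (inl i)).
  by apply: eq_bigr => i _; rewrite (unsplitK (inr i)).
- move=> a _ [n [c [h [Ah ->]]]]; exists n, (fun i => a * c i), h; split => //.
  by apply/funext => x; rewrite mulr_sumr; apply: eq_bigr => i _; rewrite mulrA.
Qed.

Lemma sub_cspan A : A `<=` cspan A.
Proof.
move=> g Ag; exists 1%N, (fun=> 1), (fun=> g); split => //.
by apply/funext => x; rewrite big_ord1 mul1r.
Qed.

Lemma cspan_sub A B : lin_closed B -> A `<=` B -> cspan A `<=` B.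
Proof.
move=> lB AB _ [n [c [h [Ah ->]]]].
by apply: lin_closed_sum => // i _; exact: AB.
Qed.

End LinearClosure.

(** * Symbols and even polynomials on the cut space *)

Section Symbols.
Variable R : realType.
Implicit Types (p : half_cotangent R).

Definition sigma_mono (j k : nat) p : R[i] :=
  sigma p ^+ j * ((sigma p)^*)%C ^+ k.

(** Since |lambda| = 1, sigma is sqrt s divided by lambda and its conjugate is
    sqrt s times lambda. *)
Lemma sigma_monoE j k d p : (j + k = 2 * d)%N ->
  sigma_mono j k p = ek (k%:Z - j%:Z) p.2 * (p.1%:num%:C) ^+ d.
Proof.
move=> jk.
have cE : ((sigma p)^*)%C = val p.2 * (Num.sqrt p.1%:num)%:C.
  rewrite /sigma rmorphM; congr (_ * _); last exact: conjc_real.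
  by rewrite /= conjc_inv circle_conjV invrK.
rewrite /sigma_mono cE /sigma !exprMn mulrACA; congr (_ * _).
  rewrite addrC ekD /ek -!exprnP; congr (_ * _).
  by rewrite -exprnN exprVn.
rewrite -exprD jk exprM -rmorphXn /= sqr_sqrtr//.
Qed.

Lemma horner2E (f : {poly {poly R[i]}}) (z w : R[i]) :
  f.[z, w] = \sum_(j < size f) \sum_(k < size f`_j) f`_j`_k * (z ^+ j * w ^+ k).
Proof.
rewrite (horner_coef f) horner_sum; apply: eq_bigr => j _.
rewrite hornerM horner_exp hornerC horner_coef mulr_suml.
by apply: eq_bigr => k _; rewrite mulrAC mulrA.
Qed.

Lemma even_pullbacks_lin_closed : lin_closed (@even_pullbacks R).
Proof.
split.
- exists 0; first by move=> z; rewrite !horner0.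
  by apply/funext => p; rewrite !horner0.
- move=> _ _ [f1 e1 ->] [f2 e2 ->]; exists (f1 + f2).
    by move=> z; rewrite !hornerD e1 e2.
  by apply/funext => p; rewrite !hornerD.
- move=> c _ [f e ->]; exists (c%:P%:P * f).
    by move=> z; rewrite !hornerM !hornerC e.
  by apply/funext => p; rewrite !hornerM !hornerC.
Qed.

Lemma sigma_mono_even_pullback j k : ~~ odd (j + k) ->
  even_pullbacks (sigma_mono j k).
Proof.
move=> jk; exists (('X^k)%:P * 'X^j); last first.
  apply/funext => p.
  by rewrite !(hornerM, hornerC, hornerXn, horner_exp) mulrC.
move=> z; rewrite !(hornerM, hornerC, hornerXn, horner_exp).
rewrite exprNn [(- z) ^+ j]exprNn mulrACA -exprD addnC -signr_odd (negPf jk).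
by rewrite expr0 mul1r.
Qed.

(** With m = (k - j) / 2 and d = (j + k) / 2, the condition |m| <= d for the
    existence of crossing_poly m d says that j and k are nonnegative. *)
Lemma sigma_mono_commuting j k : ~~ odd (j + k) ->
  commuting_symbols (sigma_mono j k).
Proof.
move=> jk; pose d := (j + k)./2.
have jkd : (j + k = 2 * d)%N by rewrite mul2n even_halfK.
pose m : int := k%:Z - d%:Z.
have m2 : k%:Z - j%:Z = 2 * m by rewrite /m; lia.
have md : (`|m| <= d)%N by rewrite /m; lia.
have sp := @size_crossing_poly R m d md.
have cd : (crossing_poly R m d)`_d = 1.
  by have /monicP := crossing_poly_monic R m d; rewrite lead_coefE sp.
exists d, (fun r l => (crossing_poly R m d)`_r * ek (2 * m) l); split.
- by move=> r _; apply: smoothZ; exact: smooth_ek.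
- exists (expi 0); rewrite cd mul1r; apply/eqP => e0.
  by have := normc_ek (2 * m) (expi (0 : R)); rewrite e0 normc0 => /eqP;
    rewrite eq_sym oner_eq0.
- by apply: commutes_mode; [rewrite sp|exact: crossing_poly_root].
- apply/funext => p; rewrite (sigma_monoE _ jkd) m2.
  by rewrite /principal_symbol cd mul1r.
Qed.

Lemma commuting_symbols_even : @commuting_symbols R `<=` @even_pullbacks R.
Proof.
move=> _ [d [f [sf _ cf ->]]].
pose j (i : nat) : int := i%:Z * 2 - (2 * d)%N%:Z.
pose b (i : nat) : R[i] := ((2 * pi)^-1)%:C * fc (f d) (j i).
have fE : f d = fun l => \sum_(i < (2 * d).+1) b i * ek (j i) l.
  have se (i : 'I_(2 * d).+1) : smooth (fun l : circle R => b i * ek (j i) l).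
    by apply: smoothZ; exact: smooth_ek.
  apply: (fc_inj (sf _ (leqnn d)) (smooth_sum _ se)) => k.
  rewrite (fc_sum _ _ se).
  under eq_bigr => i _ do rewrite (fcZ _ _ (smooth_ek (j i))) fc_ek.
  have [[i ik]|nk] := pselect (exists i : 'I_(2 * d).+1, j i = k).
    rewrite (bigD1 i)//= ik eqxx mulr1n big1 ?addr0.
      rewrite /b ik mulrAC -rmorphM /= mulVf ?mul1r//.
      by rewrite mulf_neq0 ?gt_eqF ?pi_gt0.
    move=> i' ii'; case: eqP => [ji'|_]; last by rewrite mulr0n mulr0.
    case/eqP: ii'; apply: val_inj; move: ik ji'; rewrite /j /=; lia.
  rewrite big1; last first.
    move=> i _; case: eqP => [jk|_]; last by rewrite mulr0n mulr0.
    by case: nk; exists i.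
  apply/eqP/negPn/negP => /(symbol_support sf cf)[i id ki].
  by apply: nk; exists (Ordinal (id : (i < (2 * d).+1)%N)).
have -> : (fun p : half_cotangent R => principal_symbol d f (p.1%:num, p.2)) =
    fun p => \sum_(i < (2 * d).+1) b i * sigma_mono (2 * d - i) i p.
  apply/funext => p; rewrite /principal_symbol /= fE mulr_suml.
  apply: eq_bigr => i _; rewrite -mulrA (@sigma_monoE _ _ d).
    by congr (_ * (ek _ _ * _)); rewrite /j; have := ltn_ord i; lia.
  by have := ltn_ord i; lia.
apply: lin_closed_sum even_pullbacks_lin_closed _ => i _.
apply: sigma_mono_even_pullback; rewrite subnK ?mul2n ?odd_double//.
exact: (ltn_ord i).
Qed.

(** The evenness condition bears on values, not on coefficients; averaging f
    over z and -z removes the monomials of odd degree. *)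
Lemma even_pullbacks_span : @even_pullbacks R `<=` cspan (@commuting_symbols R).
Proof.
move=> _ [f fe ->].
have lc := @cspan_lin_closed R _ (@commuting_symbols R).
pose c (j k : nat) : R[i] := f`_j`_k * ((1 + (-1) ^+ (j + k)) / 2).
have -> : (fun p => f.[sigma p, ((sigma p)^*)%C]) = fun p =>
    \sum_(j < size f) 1 * \sum_(k < size f`_j) c j k * sigma_mono j k p.
  apply/funext => p; set z := sigma p.
  have -> : f.[z, (z^*)%C] = (f.[z, (z^*)%C] + f.[- z, - (z^*)%C]) / 2.
    by rewrite fe -mulr2n -[_ *+ 2 in RHS]mulr_natr mulfK// pnatr_eq0.
  rewrite !horner2E -big_split mulr_suml; apply: eq_bigr => j _ /=.
  rewrite mul1r -big_split mulr_suml; apply: eq_bigr => k _ /=.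
  rewrite /c /sigma_mono -/z [(- z) ^+ j]exprNn [(- _) ^+ k]exprNn exprD.
  by ring.
apply: (lin_closed_sum _ lc) => j _.
apply: (lin_closed_sum _ lc) => k ck.
apply/sub_cspan/sigma_mono_commuting; apply: contra ck => jk.
by rewrite /c -signr_odd jk expr1 subrr mul0r mulr0.
Qed.

End Symbols.

Theorem theorem2p3 (R : realType) :
  cspan (@commuting_symbols R) = @even_pullbacks R.
Proof.
apply/seteqP; split; last exact: even_pullbacks_span.
apply: cspan_sub; first exact: even_pullbacks_lin_closed.
exact: commuting_symbols_even.
Qed.
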